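(* Let $G$ be a compact abelian group, $\widehat G$ its dual group of continuous characters $\gamma\colon G\to\mathbb T$, and $S\subset C(G)$ a finite-dimensional subspace (complex scalars). Then the following assertions are equivalent: (1) $S$ is left-invariant; (2) $S$ is left-accessible; (3) there exists a finite set $\Lambda\subset\widehat G$ such that $S=\operatorname{span}\{\gamma:\gamma\in\Lambda\}$. Moreover, in this case, $$\boldsymbol\lambda(S)=\int_G\Big|\sum_{\gamma\in\Lambda}\gamma(g)\Big|\,d\mu_G(g),$$ where $\mu_G$ is the normalized Haar measure on $G$.
   Context: All function spaces are complex; $C(G)$ carries the supremum norm. $G$ acts on itself by left multiplication, with translation operators $(L_gf)(x)=f(g^{-1}x)$. A subspace $S\subset C(G)$ is left-invariant if $L_g(S)\subset S$ for all $g\in G$. A (bounded linear) projection $Q\colon C(G)\to S$ is equivariant if $QL_g=L_gQ$ for all $g\in G$. A finite-dimensional left-invariant subspace $S$ is left-accessible if every equivariant projection $Q\colon C(G)\to S$ coincides with the restriction to $C(G)$ of the orthogonal projection $L_2(G,\mu_G)\to S$. Projection constants: $\boldsymbol\lambda(X,Y)=\inf\{\|P\|: P\in\mathcal L(Y),\ P^2=P,\ P(Y)=X\}$ for a subspace $X$ of a Banach space $Y$, and $\boldsymbol\lambda(X)=\sup_Y\boldsymbol\lambda(X,Y)$ over all Banach spaces $Y$ containing $X$ isometrically; $S$ carries the supremum norm. *)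

(* Defs.v *)
From HB Require Import structures.
From mathcomp Require Import all_boot all_order all_algebra.
From mathcomp Require Import all_classical all_reals all_analysis.
From mathcomp Require Import complex.

Set Implicit Arguments.
Unset Strict Implicit.
Unset Printing Implicit Defensive.

Import Order.TTheory GRing.Theory Num.Theory.
Import numFieldNormedType.Exports.

Local Open Scope classical_set_scope.
Local Open Scope ring_scope.

(* Conventions.
   - The compact abelian group is written additively, so that the left
     translate x |-> f (g^-1 x) reads x |-> f (- g + x).
   - Complex-valued functions have type [G -> R[i]^o]: the library's topology,
     norm and R[i]-module structure on the complex numbers are those of the
     regular module R[i]^o (R[i] itself is canonically only an R-module).
   - Norms over R[i] take their values in R[i]; [rnorm] is the same norm seen
     as an element of R. *)

Section NormedSpaces.
Variable R : realType.

Definition rnorm (V : normedModType R[i]) (v : V) : R := complex.Re `|v|.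

Definition opnorm (Y : normedModType R[i]) (P : Y -> Y) : \bar R :=
  ereal_sup [set (rnorm (P y))%:E | y in [set y | `|y| <= 1]].

(* relative projection constant lambda(X, Y); +oo if X is not complemented *)
Definition rel_proj_const (Y : normedModType R[i]) (X : set Y) : \bar R :=
  ereal_inf [set opnorm P | P in [set P : {linear Y -> Y} |
    [/\ continuous P, (forall y, P (P y) = P y) & range P = X]]].

Definition isometric_embedding (V : lmodType R[i]) (X : set V) (N : V -> R)
    (Y : normedModType R[i]) (j : V -> Y) : Prop :=
  (forall a u v, X u -> X v -> j (a *: u + v) = a *: j u + j v) /\
  (forall u, X u -> rnorm (j u) = N u).

(* absolute projection constant lambda(X) of the linear subspace X of V,
   normed by N; V carries no norm, and N is only used on X *)
Definition abs_proj_const (V : lmodType R[i]) (X : set V) (N : V -> R) :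
    \bar R :=
  ereal_sup [set l | exists (Y : completeNormedModType R[i]) (j : V -> Y),
    isometric_embedding X N j /\ l = rel_proj_const (j @` X)].

Definition lin_span (V : lmodType R[i]) (A : set V) : set V :=
  [set v | exists n (c : 'I_n -> R[i]) (b : 'I_n -> V),
    (forall k, A (b k)) /\ v = \sum_(k < n) c k *: b k].

Definition findim_subspace (V : lmodType R[i]) (S : set V) : Prop :=
  exists B : set V, finite_set B /\ S = lin_span B.

End NormedSpaces.

(* G with its Borel sigma-algebra.  Measurable types are pointed, hence the
   alias, pointed at 0. *)
Definition pointed_group (G : topologicalZmodType) : Type := G.
HB.instance Definition _ (G : topologicalZmodType) :=
  Choice.on (pointed_group G).
HB.instance Definition _ (G : topologicalZmodType) :=
  isPointed.Build (pointed_group G) (0 : G).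

Notation borel G :=
  (g_sigma_algebraType (@open G : set (set (pointed_group G)))).

Section Group.
Variables (R : realType) (G : topologicalZmodType).

Definition continuous_functions : set (G -> R[i]^o) := [set f : G -> R[i]^o | continuous f].

Definition sup_norm (f : G -> R[i]^o) : R := sup [set rnorm (f x) | x in setT].

Definition translate (g : G) (f : G -> R[i]^o) : G -> R[i]^o :=
  fun x => f (- g + x).

Definition left_invariant (S : set (G -> R[i]^o)) : Prop :=
  forall g f, S f -> S (translate g f).

(* the dual group; gamma is valued in the unit circle *)
Definition dual_group : set (G -> R[i]^o) :=
  [set gamma : G -> R[i]^o | [/\ continuous gamma, (forall x, `|gamma x| = 1) &
    forall x y, gamma (x + y) = gamma x * gamma y]].

(* The conditions on Q only concern its restriction to continuous functions. *)
Definition equivariant_projection (S : set (G -> R[i]^o))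
    (Q : (G -> R[i]^o) -> (G -> R[i]^o)) : Prop :=
  let CG := continuous_functions in
  [/\ (forall a f h, CG f -> CG h -> Q (a *: f + h) = a *: Q f + Q h),
      (exists M, forall f, CG f -> sup_norm (Q f) <= M * sup_norm f),
      (forall f, CG f -> S (Q f)),
      (forall s, S s -> Q s = s) &
      (forall g f, CG f -> Q (translate g f) = translate g (Q f))].

Variable mu : probability (borel G) R.

(* Normalized Haar measure: the invariant regular Borel probability measure.
   Regularity is part of the definition since G need not be metrizable. *)
Definition is_haar : Prop :=
  [/\ (forall (g : G) (A : set (borel G)), measurable A ->
         mu [set g + x | x in (A : set G)] = mu A),
      (forall A : set (borel G), measurable A ->
         mu A = ereal_inf [set mu U | U in [set U | @open G U /\ A `<=` U]]) &
      (forall A : set (borel G), measurable A ->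
         mu A = ereal_sup [set mu K | K in [set K | @compact G K /\ K `<=` A]])].

Definition integralC (f : G -> R[i]^o) : R[i] :=
  Complex (\int[mu]_x complex.Re (f x)) (\int[mu]_x complex.Im (f x)).

Definition L2_functions : set (G -> R[i]^o) :=
  [set f : G -> R[i]^o | [/\ measurable_fun [set: borel G] (fun x => complex.Re (f x) : R),
               measurable_fun [set: borel G] (fun x => complex.Im (f x) : R) &
               (\int[mu]_x ((rnorm (f x)) ^+ 2)%:E < +oo)%E]].

Definition L2_inner (f h : G -> R[i]^o) : R[i] :=
  integralC (fun x => f x * conjc (h x)).

(* P maps (representatives of) elements of L_2 to their orthogonal projection
   on S, viewed as a space of functions *)
Definition L2_orthogonal_projection (S : set (G -> R[i]^o))
    (P : (G -> R[i]^o) -> (G -> R[i]^o)) : Prop :=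
  forall f, L2_functions f ->
    S (P f) /\ (forall s, S s -> L2_inner (f - P f) s = 0).

Definition left_accessible (S : set (G -> R[i]^o)) : Prop :=
  [/\ findim_subspace S, left_invariant S &
      exists P, L2_orthogonal_projection S P /\
        forall Q, equivariant_projection S Q ->
          forall f, continuous_functions f -> Q f = P f].

End Group.

Arguments continuous_functions R G : clear implicits.
Arguments dual_group R G : clear implicits.

(* Main.v *)
(* A finite-dimensional invariant space of continuous functions carries the
   commuting family of translations, so it contains a common eigenfunction,
   i.e. a multiple of a character; splitting off the (finitely many,
   orthonormal) characters of S leaves an invariant space without characters,
   which is 0.

   Let D be the sum of the characters spanning S.  Convolution by D is the
   orthogonal projection on S.  Averaging a projection P over translations,
   g |-> L_g^-1 P L_g, yields this convolution; hence it is the only equivariant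
   projection, and its norm, the L_1-norm of D, bounds |P| from below.
   Conversely, if S sits in a Banach space Y, the evaluations at the points of
   G extend from S to Y without increase of the norm, and integrating these
   extensions against D gives a projection of Y on S of norm |D|_1.  Integrals
   of operators are avoided by using Riemann sums that are uniformly accurate
   for finitely many continuous functions on G * G; the resulting almost
   projections are corrected by a small operator. *)
From HB Require Import structures.
Require Import Defs.
From mathcomp Require Import all_boot all_order all_algebra.
From mathcomp Require Import all_classical all_reals all_analysis.
From mathcomp Require Import measurable_realfun complex ring lra.
Import Order.TTheory GRing.Theory Num.Theory.
Import numFieldNormedType.Exports.
Local Open Scope classical_set_scope.
Local Open Scope ring_scope.
Set Implicit Arguments.
Unset Strict Implicit.
Unset Printing Implicit Defensive.
Local Open Scope complex_scope.

(** * Norms over the complex numbers and the Hahn-Banach theorem *)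

(** Hahn-Banach extends the evaluation at each point of the group separately, with no continuity or
    measurability in the point, so an integral of these extensions has no meaning while a finite sum
    does. In the upper bound the Riemann sums are therefore chosen for kernels built from characters
    alone, and their weights and sample points are then reused for the extensions. In the lower
    bound an average of operators is replaced by a bounded functional applied to a finite
    combination of translates; the combination must be close to its limit in supremum norm, which is
    why the sums have to be accurate uniformly in the remaining variable.

    The constant |D|_1 rests on two sharp facts: evaluations have norm at most 1, and all translates
    of |D| have the same integral. Every other constant, such as the factor 2 from splitting
    integrals into real and imaginary parts, only multiplies an error that tends to 0. As the
    relative projection constant is an infimum, exact projections of norm at most |D|_1 + e suffice,
    and no limit of operators is taken. *)

Section Rnorm.
Variables (R : realType) (V : normedModType R[i]).
Implicit Types (u v : V) (a : R[i]).

Lemma rnormE v : (rnorm v)%:C = `|v|.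
Proof. by rewrite /rnorm RRe_real// normr_real. Qed.

Lemma rnorm_ge0 v : 0 <= rnorm v.
Proof. by rewrite -ler0c rnormE. Qed.

Lemma rnorm_le v (M : R) : (rnorm v <= M) = (`|v| <= M%:C).
Proof. by rewrite -lecR rnormE. Qed.

Lemma rnorm0 : rnorm (0 : V) = 0.
Proof. by rewrite /rnorm normr0. Qed.

Lemma rnormN v : rnorm (- v) = rnorm v.
Proof. by rewrite /rnorm normrN. Qed.

Lemma rnormD u v : rnorm (u + v) <= rnorm u + rnorm v.
Proof. by rewrite -lecR rmorphD /= !rnormE ler_normD. Qed.

Lemma rnormB u v : rnorm (u - v) = rnorm (v - u).
Proof. by rewrite /rnorm distrC. Qed.

Lemma rnormZ a v : rnorm (a *: v) = rnorm (a : R[i]^o) * rnorm v.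
Proof. by apply: (@complexI R); rewrite rmorphM /= !rnormE normrZ. Qed.

Lemma rnorm_sum I (r : seq I) (P : pred I) (F : I -> V) :
  rnorm (\sum_(i <- r | P i) F i) <= \sum_(i <- r | P i) rnorm (F i).
Proof.
elim/big_rec2: _ => [|i x y _ h]; first by rewrite rnorm0.
by rewrite (le_trans (rnormD _ _))// lerD2l.
Qed.

Lemma rnorm_eq0 v : rnorm v = 0 -> v = 0.
Proof. by move=> v0; apply/normr0_eq0; rewrite -rnormE v0. Qed.

End Rnorm.

Section Rnorm_complex.
Variable R : realType.
Implicit Types z w : R[i]^o.

Lemma rnormM z w : rnorm (z * w : R[i]^o) = rnorm z * rnorm w.
Proof. exact: rnormZ. Qed.

Lemma rnorm_sqr z : rnorm z ^+ 2 = (complex.Re z) ^+ 2 + (complex.Im z) ^+ 2.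
Proof. by apply: (@complexI R); rewrite rmorphXn /= rnormE -add_Re2_Im2. Qed.

Lemma normr_Re z : `|complex.Re z| <= rnorm z.
Proof.
rewrite -(@ler_pXn2r _ 2)// ?nnegrE ?rnorm_ge0//.
by rewrite rnorm_sqr real_normK ?num_real// lerDl sqr_ge0.
Qed.

Lemma normr_Im z : `|complex.Im z| <= rnorm z.
Proof.
rewrite -(@ler_pXn2r _ 2)// ?nnegrE ?rnorm_ge0//.
by rewrite rnorm_sqr real_normK ?num_real// lerDr sqr_ge0.
Qed.

Lemma Re_le_rnorm z : complex.Re z <= rnorm z.
Proof. exact: le_trans (ler_norm _) (normr_Re z). Qed.

Lemma rnorm_real (x : R) : rnorm (x%:C : R[i]^o) = `|x|.
Proof. by rewrite /rnorm normc_def /= expr0n addr0 sqrtr_sqr. Qed.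

Lemma rnorm_le_ReIm z : rnorm z <= `|complex.Re z| + `|complex.Im z|.
Proof.
rewrite -(@ler_pXn2r _ 2)// ?nnegrE ?rnorm_ge0 ?addr_ge0//.
rewrite rnorm_sqr sqrrD !real_normK ?num_real//.
by rewrite addrAC lerDl mulrn_wge0// mulr_ge0.
Qed.

Lemma rnormJ z : rnorm (conjc z : R[i]^o) = rnorm z.
Proof. by rewrite /rnorm normcJ. Qed.

Lemma mulrJ_rnorm z : z * conjc z = (rnorm z ^+ 2)%:C.
Proof. by rewrite rmorphXn /= rnormE sqr_normc. Qed.

Lemma cReD z w : complex.Re (z + w) = complex.Re z + complex.Re w.
Proof. by case: z w => [? ?] []. Qed.
Lemma cImD z w : complex.Im (z + w) = complex.Im z + complex.Im w.
Proof. by case: z w => [? ?] []. Qed.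
Lemma cReM z w : complex.Re (z * w) =
  complex.Re z * complex.Re w - complex.Im z * complex.Im w.
Proof. by case: z w => [? ?] []. Qed.
Lemma cImM z w : complex.Im (z * w) =
  complex.Re z * complex.Im w + complex.Im z * complex.Re w.
Proof. by case: z w => [? ?] [? ?] /=. Qed.

Lemma Re_realM (x : R) z : complex.Re (x%:C * z) = x * complex.Re z.
Proof. by rewrite cReM /= mul0r subr0. Qed.
Lemma Im_realM (x : R) z : complex.Im (x%:C * z) = x * complex.Im z.
Proof. by rewrite cImM /= mul0r addr0. Qed.

End Rnorm_complex.

Section HahnBanach.
Variables (R : realType) (Y : normedModType R[i]) (M : R).
Hypothesis M0 : 0 <= M.

(** A partial real-linear functional is encoded by its graph, so that extension is inclusion and the
    union of a chain is again a candidate. Single-valuedness is not imposed: the difference of two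
    pairs over the same point lies over 0, where domination leaves only the value 0. *)
Definition dominated_graph (g : set (Y * R)) :=
  [/\ g (0, 0),
      (forall p q, g p -> g q -> g (p.1 + q.1, p.2 + q.2)),
      (forall a p, g p -> g (a%:C *: p.1, a * p.2)) &
      (forall p, g p -> p.2 <= M * rnorm p.1)].

Lemma dominated_graph_functional g y r s :
  dominated_graph g -> g (y, r) -> g (y, s) -> r = s.
Proof.
have le g' y' r' s' : dominated_graph g' -> g' (y', r') -> g' (y', s') -> r' <= s'.
  case=> _ gD gZ gM gr gs; have := gD _ _ gr (gZ (-1) _ gs).
  move=> /gM /=; rewrite rmorphN1 scaleN1r subrr rnorm0 mulr0 mulN1r.
  by rewrite subr_le0.
by move=> gdom gr gs; apply: le_anti; rewrite (le g y)// (le g y).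
Qed.

Lemma dominated_graph_extend g y0 : dominated_graph g ->
  exists2 g', dominated_graph g' & g `<=` g' /\ exists r, g' (y0, r).
Proof.
move=> [g0 gD gZ gM].
pose p y : R := M * rnorm (y : Y).
have pD y z : p (y + z) <= p y + p z by rewrite -mulrDr ler_wpM2l// rnormD.
(* Domination at [q.1 - y0] and at [q'.1 + y0] bounds the value at [y0] from below and from above.
   The triangle inequality puts every lower bound under every upper bound, so the supremum of the
   lower bounds is admissible. *)
pose E := [set q.2 - p (q.1 - y0) | q in g].
have key q q' : g q -> g q' -> q.2 - p (q.1 - y0) <= p (q'.1 + y0) - q'.2.
  move=> gq gq'; have /gM/= := gD _ _ gq gq'.
  have := pD (q.1 - y0) (q'.1 + y0); rewrite addrACA (addrC (- y0)) subrr addr0.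
  rewrite /p => h1 h2; by rewrite lerBlDr addrAC lerBrDr (le_trans h2)// (le_trans h1)// addrC.
have Esup : has_sup E.
  split; first by exists (0 - p (0 - y0)); exists (0, 0).
  by exists (p (0 + y0) - 0) => _ [q gq <-]; exact: (key _ (0, 0)).
pose c := sup E.
have c_ge q : g q -> q.2 - p (q.1 - y0) <= c.
  by move=> gq; apply: sup_upper_bound => //; exists q.
have c_le q : g q -> c <= p (q.1 + y0) - q.2.
  move=> gq; apply: ge_sup; first by case: Esup.
  by move=> _ [q' gq' <-]; exact: key.
have pZ (a : R) y : 0 <= a -> p (a%:C *: y) = a * p y.
  by move=> a0; rewrite /p rnormZ rnorm_real ger0_norm// mulrCA.
exists [set q | exists a q0, g q0 /\ q = (q0.1 + a%:C *: y0, q0.2 + a * c)].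
  split.
  - by exists 0, (0, 0); split => //=; rewrite scale0r mul0r !addr0.
  - move=> _ _ [a [q [gq ->]]] [b [q' [gq' ->]]] /=.
    exists (a + b), (q.1 + q'.1, q.2 + q'.2); split; first exact: gD.
    by rewrite /= rmorphD scalerDl mulrDl addrACA [q.2 + _ + _]addrACA.
  - move=> b _ [a [q [gq ->]]] /=.
    exists (b * a), (b%:C *: q.1, b * q.2); split; first exact: gZ.
    by rewrite /= rmorphM scalerDr mulrDr scalerA mulrA.
  (* Dividing by [|a|] reduces to the coefficients 1 and -1 of [y0], that is, to [c_le] and
     [c_ge]. *)
  - move=> _ [a [q [gq ->]]] /=; rewrite -/(p _).
    have [a0|a0|->] := ltrgtP a 0; last 1 first.
    + by rewrite scale0r mul0r !addr0; exact: gM.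
    + have b0 : 0 < - a by rewrite oppr_gt0.
      have /c_ge := gZ (- a)^-1 _ gq.
      rewrite /= => cge.
      have -> : q.1 + a%:C *: y0 = (- a)%:C *: ((- a)^-1%:C *: q.1 - y0).
        rewrite scalerBr scalerA -rmorphM mulfV ?gt_eqF// scale1r.
        by rewrite rmorphN scaleNr opprK.
      rewrite (pZ _ _ (ltW b0)); move: cge; rewrite -(ler_pM2l b0) mulrBr mulrA.
      rewrite mulfV ?gt_eqF// mul1r => h. lra.
    + have /c_le := gZ a^-1 _ gq.
      rewrite /= => cle.
      have -> : q.1 + a%:C *: y0 = a%:C *: (a^-1%:C *: q.1 + y0).
        by rewrite scalerDr scalerA -rmorphM mulfV ?gt_eqF// scale1r.
      rewrite (pZ _ _ (ltW a0)); move: cle; rewrite -(ler_pM2l a0) mulrBr [a * (a^-1 * _)]mulrA.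
      rewrite mulfV ?gt_eqF// mul1r => h. lra.
split.
  move=> q gq; exists 0, q; split => //.
  by rewrite scale0r mul0r !addr0; case: q gq.
exists c, 1, (0, 0); split => //=.
by rewrite scale1r mul1r !add0r.
Qed.

Lemma dominated_graph_total g : dominated_graph g ->
  exists2 g', dominated_graph g' & g `<=` g' /\ forall y, exists r, g' (y, r).
Proof.
move=> gdom.
have [A [[Adom gA] Amax]] : exists A, (dominated_graph A /\ g `<=` A) /\
    forall B, A `<` B -> ~ (dominated_graph B /\ g `<=` B).
  (* Adjoining [g] to every candidate takes care of the empty chain: its union stands for [g] and
     not for the empty set, which is no dominated graph. *)
  have [|A [PA Amax]] := @Zorn_bigcup _
      [set A | dominated_graph (g `|` A) /\ g `<=` g `|` A].
    move=> F FP totF; split; last exact: subsetUl.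
    have chain p q : (g `|` \bigcup_(X in F) X) p ->
        (g `|` \bigcup_(X in F) X) q ->
        exists2 X, X `<=` \bigcup_(X in F) X & dominated_graph (g `|` X) /\
        (g `|` X) p /\ (g `|` X) q.
      move=> [gp|[X FX Xp]] [gq|[Z FZ Zq]].
      - exists set0 => //; rewrite setU0.
        by split=> //; split.
      - exists Z; first exact: bigcup_sup.
        by have [? _] := FP _ FZ; split=> //; split; [left|right].
      - exists X; first exact: bigcup_sup.
        by have [? _] := FP _ FX; split=> //; split; [right|left].
      - have [XZ|ZX] := totF _ _ FX FZ.
          exists Z; first exact: bigcup_sup.
          have [? _] := FP _ FZ; split=> //; split; right => //; exact: XZ.
        exists X; first exact: bigcup_sup.
        have [? _] := FP _ FX; split=> //; split; right => //; exact: ZX.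
    split.
    - by left; case: gdom.
    - move=> p q Up Uq; have [X XU [[_ XD _ _] [Xp Xq]]] := chain _ _ Up Uq.
      by have [|/XU] := XD _ _ Xp Xq; [left|right].
    - move=> a p Up; have [X XU [[_ _ XZ _] [Xp _]]] := chain _ _ Up Up.
      by have [|/XU] := XZ a _ Xp; [left|right].
    - move=> p Up; have [X XU [[_ _ _ XM] [Xp _]]] := chain _ _ Up Up.
      exact: XM.
  exists (g `|` A); split; first exact: PA.
  move=> B AB [Bdom gB]; apply: (Amax B).
    split; first by move=> p Ap; apply: (properW AB); right.
    move=> BA; case: AB => AB nBA; apply: nBA => p /BA Ap; by right.
  have gUB : g `|` B = B.
    by apply/seteqP; split=> [p [/gB|]|p Bp] //; right.
  by rewrite /= gUB.
exists A => //; split=> // y.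
have [g' g'dom [Ag' [r g'r]]] := dominated_graph_extend y Adom.
exists r; apply: contrapT => nAr; apply: (Amax g'); last first.
  by split=> //; exact: subset_trans Ag'.
by split=> // g'A; apply: nAr; exact: g'A.
Qed.

(* The complex functional with real part [f] is [y |-> f y - i f (i y)]; its
   modulus at [y] is the value of [f] at a unimodular multiple of [y]. *)
Theorem Hahn_Banach (V : lmodType R[i]) (S : set V) (j : V -> Y) (phi : V -> R[i]^o) :
  S 0 -> (forall a u v, S u -> S v -> S (a *: u + v)) ->
  (forall a u v, S u -> S v -> j (a *: u + v) = a *: j u + j v) ->
  (forall a u v, S u -> S v -> phi (a *: u + v) = a *: phi u + phi v) ->
  (forall u, S u -> rnorm (phi u) <= M * rnorm (j u)) ->
  exists psi : Y -> R[i]^o,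
    [/\ forall a x y, psi (a *: x + y) = a *: psi x + psi y,
        forall y, rnorm (psi y) <= M * rnorm y &
        forall u, S u -> psi (j u) = phi u].
Proof.
move=> S0 Slin jlin philin phiM.
have j0 : j 0 = 0.
  by have := jlin (-1) 0 0 S0 S0; rewrite scaler0 addr0 scaleN1r addNr.
have phi0 : phi 0 = 0.
  by have := philin (-1) 0 0 S0 S0; rewrite scaler0 addr0 scaleN1r addNr.
(* That [phi] factors through [j] on [S] needs no separate check: it is contained in the domination
   of this graph. *)
pose g0 : set (Y * R) := [set (j u, complex.Re (phi u)) | u in S].
have g0dom : dominated_graph g0.
  split.
  - by exists 0; rewrite // j0 phi0.
  - move=> _ _ [u Su <-] [v Sv <-] /=; exists (1 *: u + v); first exact: Slin.
    by rewrite jlin// philin// !scale1r cReD.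
  - move=> a _ [u Su <-] /=; exists (a%:C *: u + 0); first exact: Slin.
    by rewrite jlin// philin// j0 phi0 !addr0 [complex.Re _]Re_realM.
  - by move=> _ [u Su <-] /=; apply: le_trans (phiM _ Su); exact: Re_le_rnorm.
have [g gdom [g0g gtot]] := dominated_graph_total g0dom.
have [f fg] := choice gtot.
have fun_f y r : g (y, r) -> f y = r by exact: dominated_graph_functional.
have [_ gD gZ gM] := gdom.
have fD x y : f (x + y) = f x + f y by apply: fun_f; exact: (gD (_, _) (_, _)).
have fZ (a : R) y : f (a%:C *: y) = a * f y by apply: fun_f; exact: (gZ a (_, _)).
have fM y : f y <= M * rnorm y by exact: (gM (_, _)).
pose psi y : R[i]^o := (f y)%:C - 'i * (f ('i *: y))%:C.
have ii : 'i * 'i = -1 :> R[i] by rewrite -expr2 sqr_i.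
have fii y : f ('i *: ('i *: y)) = - f y.
  by rewrite scalerA ii -(rmorphN1 (real_complex R)) fZ mulN1r.
have psiD x y : psi (x + y) = psi x + psi y.
  by rewrite /psi scalerDr !fD !rmorphD /= mulrDr opprD addrACA.
have psiR (a : R) y : psi (a%:C *: y) = a%:C * psi y.
  rewrite /psi scalerA ['i * a%:C]mulrC -scalerA !fZ !rmorphM /= mulrBr.
  by rewrite ['i * (_ * _)]mulrCA.
have psii y : psi ('i *: y) = 'i * psi y.
  rewrite /psi fii rmorphN /= mulrBr mulrA ii; ring.
have psiZ (a : R[i]) y : psi (a *: y) = a * psi y.
  rewrite {1}[a]complexE scalerDl psiD psiR -scalerA psii psiR mulrA -mulrDl.
  by rewrite -complexE.
have Repsi y : complex.Re (psi y) = f y.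
  by rewrite /psi /= !mul0r ?mul1r ?subr0 ?oppr0 ?addr0.
exists psi; split.
- by move=> a x y; rewrite psiD psiZ.
- move=> y; have [->|/eqP z0] := eqVneq (psi y) 0.
    by rewrite rnorm0 mulr_ge0 ?rnorm_ge0.
  have n0 : 0 < rnorm (psi y).
    by rewrite lt_neqAle rnorm_ge0 andbT eq_sym; apply/eqP => /rnorm_eq0.
  pose a : R[i] := conjc (psi y) * (rnorm (psi y))^-1%:C.
  have apsi : a * psi y = (rnorm (psi y))%:C.
    rewrite /a mulrAC [conjc _ * _]mulrC mulrJ_rnorm -rmorphM /=.
    by rewrite expr2 mulfK ?gt_eqF.
  have na : rnorm (a : R[i]^o) = 1.
    rewrite rnormM rnormJ rnorm_real gtr0_norm ?invr_gt0//.
    by rewrite mulfV ?gt_eqF.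
  have := fM (a *: y); rewrite -Repsi psiZ apsi /= rnormZ na mul1r.
  exact.
- move=> u Su.
  have fj v : S v -> f (j v) = complex.Re (phi v).
    by move=> Sv; apply: fun_f; apply: g0g; exists v.
  have Siu : S ('i *: u + 0) by exact: Slin.
  have : f ('i *: j u) = complex.Re ('i * phi u).
    by have := fj _ Siu; rewrite jlin// philin// j0 phi0 !addr0.
  rewrite /psi => ->; rewrite fj//.
  by rewrite ['i * phi u]mulrC ReiNIm rmorphN /= mulrN opprK -complexE.
Qed.

End HahnBanach.

(** * The Banach space of bounded functions *)

Section SupNorm.
Variables (R : realType) (G : topologicalZmodType).
Implicit Types f : G -> R[i]^o.

Definition bounded_fct : {pred G -> R[i]^o} :=
  [pred f | `[< exists M : R, forall x, rnorm (f x) <= M >]].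

Lemma bounded_fctP f :
  reflect (exists M : R, forall x, rnorm (f x) <= M) (f \in bounded_fct).
Proof. exact: asboolP. Qed.

Lemma sup_norm_ub f x : f \in bounded_fct -> rnorm (f x) <= sup_norm f.
Proof.
move=> /bounded_fctP[M fM]; apply: sup_upper_bound; last by exists x.
by split; [exists (rnorm (f 0)), 0 | exists M => _ [y _ <-]].
Qed.

Lemma sup_norm_le f (M : R) : (forall x, rnorm (f x) <= M) -> sup_norm f <= M.
Proof.
move=> fM; apply: ge_sup; first by exists (rnorm (f 0)), 0.
by move=> _ [y _ <-].
Qed.

Lemma sup_norm_ge0 f : f \in bounded_fct -> 0 <= sup_norm f.
Proof. by move=> bf; exact: le_trans (rnorm_ge0 _) (sup_norm_ub 0 bf). Qed.

Fact bounded_fct_submod_closed : submod_closed bounded_fct.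
Proof.
split; first by apply/bounded_fctP; exists 0 => x; rewrite rnorm0.
move=> a f g /bounded_fctP[M fM] /bounded_fctP[N gN]; apply/bounded_fctP.
exists (rnorm (a : R[i]^o) * M + N) => x.
rewrite (le_trans (rnormD _ _))// lerD// [leLHS]rnormZ.
by rewrite ler_wpM2l ?rnorm_ge0.
Qed.

HB.instance Definition _ :=
  GRing.isSubmodClosed.Build R[i] (G -> R[i]^o) bounded_fct
    bounded_fct_submod_closed.

(** The superspace of [S] that witnesses the lower bound. Bounded functions are taken instead of
    continuous ones because their completeness is a purely pointwise matter; projections of this
    space are only tested on continuous functions. *)
Record bfct := BFct { bfct_val :> G -> R[i]^o; bfctP : bfct_val \in bounded_fct }.
HB.instance Definition _ := [isSub for bfct_val].
HB.instance Definition _ := [Choice of bfct by <:].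
HB.instance Definition _ := [SubChoice_isSubLmodule of bfct by <:].

Definition bfct_norm (f : bfct) : R[i] := (sup_norm f)%:C.

Fact bfct_normD (f g : bfct) : bfct_norm (f + g) <= bfct_norm f + bfct_norm g.
Proof.
rewrite /bfct_norm -rmorphD lecR; apply: sup_norm_le => x.
rewrite (le_trans (rnormD _ _))// lerD//; apply: sup_norm_ub => //; exact: bfctP.
Qed.

Fact bfct_normZ (a : R[i]) (f : bfct) : bfct_norm (a *: f) = `|a| * bfct_norm f.
Proof.
rewrite /bfct_norm -(@rnormE R R[i]^o) -rmorphM; congr (_%:C).
have le (b : R[i]) (g : G -> R[i]^o) : g \in bounded_fct ->
    sup_norm (b *: g) <= rnorm (b : R[i]^o) * sup_norm g.
  move=> bg; apply: sup_norm_le => x; rewrite [leLHS]rnormZ ler_wpM2l ?rnorm_ge0//.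
  exact: sup_norm_ub.
have bf := bfctP f.
have baf : (a *: bfct_val f) \in bounded_fct by exact: rpredZ.
apply: le_anti; rewrite (le a f bf) /=.
have [->|a0] := eqVneq a 0.
  by rewrite scale0r rnorm0 mul0r; apply: sup_norm_ge0; exact: rpred0.
(* The reverse inequality is [le] for the scalar [a^-1] and the function [a *: f]. *)
have /(ler_wpM2l (rnorm_ge0 (a : R[i]^o))) := le a^-1 (a *: bfct_val f) baf.
rewrite scalerA mulVf// scale1r mulrA -rnormM [a * _]mulfV//.
by rewrite (rnorm_real 1) normr1 mul1r.
Qed.

Fact bfct_norm_eq0 (f : bfct) : bfct_norm f = 0 -> f = 0.
Proof.
move=> [f0]; apply/val_inj/funext => x /=; apply/rnorm_eq0/le_anti.
rewrite rnorm_ge0 andbT -f0; apply: sup_norm_ub; exact: bfctP.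
Qed.

HB.instance Definition _ := Lmodule_isNormed.Build R[i] bfct
  bfct_normD bfct_normZ bfct_norm_eq0.

Lemma rnorm_bfct (f : bfct) : rnorm f = sup_norm f.
Proof. by []. Qed.

Lemma rnorm_bfct_ub (f : bfct) x : rnorm (f x) <= rnorm f.
Proof. by rewrite rnorm_bfct; apply: sup_norm_ub; exact: bfctP. Qed.

Lemma ball_bfct (f g : bfct) (e : R) : ball f e%:C g <-> rnorm (f - g) < e.
Proof. by rewrite -ball_normE /= -ltcR rnormE. Qed.

Lemma cauchy_real_coordinate (F : set_system bfct) (L : bfct -> R) :
  ProperFilter F -> cauchy F -> (forall f g : bfct, `|L f - L g| <= rnorm (f - g)) ->
  exists l : R^o, L g @[g --> F] --> l.
Proof.
move=> FF /cauchyP Fc Llip; suff : [cvg L g @[g --> F] in R^o] by move=> /cvg_ex.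
apply: cauchy_cvg; apply: cauchy_exP => e e0.
have [|f Ff] := Fc e%:C; first by rewrite ltcR.
exists (L f); have : F [set g | `|L f - L g| < e].
  by apply: filterS Ff => g /ball_bfct; exact: le_lt_trans (Llip _ _).
by rewrite -ball_normE.
Qed.

Lemma bfct_complete (F : set_system bfct) : ProperFilter F -> cauchy F -> cvg F.
Proof.
move=> FF Fc.
have cvRe x : exists l : R^o, complex.Re (bfct_val g x) @[g --> F] --> l.
  apply: cauchy_real_coordinate => // f g; rewrite -raddfB.
  exact: le_trans (normr_Re _) (rnorm_bfct_ub (f - g) x).
have cvIm x : exists l : R^o, complex.Im (bfct_val g x) @[g --> F] --> l.
  apply: cauchy_real_coordinate => // f g; rewrite -raddfB.
  exact: le_trans (normr_Im _) (rnorm_bfct_ub (f - g) x).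
have [hr hrF] := choice cvRe; have [hi hiF] := choice cvIm.
pose h x : R[i]^o := Complex (hr x) (hi x).
(* With [f] fixed, the bound on the ball passes to the pointwise limit along [F], uniformly in [x].
   Real and imaginary parts are estimated separately, hence [e + e]. *)
have close (f : bfct) (e : R) : 0 < e -> F (ball f e%:C) ->
    forall x, rnorm (f x - h x) <= e + e.
  move=> e0 Ff x; apply: le_trans (rnorm_le_ReIm _) _; rewrite lerD//.
    rewrite [complex.Re _]raddfB /=.
    have cv : `|complex.Re (f x) - complex.Re (bfct_val g x)| @[g --> F] -->
        `|complex.Re (f x) - hr x|.
      by apply: cvg_norm; apply: cvgB; [exact: cvg_cst|exact: hrF].
    apply: (cvgr_to_le cv); apply: filterS Ff => g /ball_bfct /ltW fg.
    rewrite -raddfB; apply: le_trans (normr_Re _) _.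
    exact: le_trans (rnorm_bfct_ub (f - g) x) fg.
  rewrite [complex.Im _]raddfB /=.
  have cv : `|complex.Im (f x) - complex.Im (bfct_val g x)| @[g --> F] -->
      `|complex.Im (f x) - hi x|.
    by apply: cvg_norm; apply: cvgB; [exact: cvg_cst|exact: hiF].
  apply: (cvgr_to_le cv); apply: filterS Ff => g /ball_bfct /ltW fg.
  rewrite -raddfB; apply: le_trans (normr_Im _) _.
  exact: le_trans (rnorm_bfct_ub (f - g) x) fg.
have Fc' (e : R) : 0 < e -> exists f : bfct, F (ball f e%:C).
  by move=> e0; move/cauchyP : Fc => /(_ e%:C); apply; rewrite ltcR.
have bh : h \in bounded_fct.
  have [f Ff] := Fc' 1 ltr01; apply/bounded_fctP; exists (1 + 1 + rnorm f) => x.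
  rewrite -[h x](subrK (f x)) (le_trans (rnormD _ _))// lerD ?rnorm_bfct_ub//.
  by rewrite rnormB; exact: (close f _ ltr01 Ff x).
apply/cvg_ex; exists (BFct bh); apply/cvg_ballP => e.
case: e => e e'; rewrite ltcE /= => /andP[/eqP -> {e'} e0].
(* The limit is within [2 * (e / 4)] of [f], and [f] is within [e / 4] of [g]. *)
have e4 : 0 < e / 4 by rewrite divr_gt0.
have [f Ff] := Fc' _ e4.
apply: filterS (Ff) => g /ball_bfct fg; apply/ball_bfct.
have : rnorm (BFct bh - f) <= e / 4 + e / 4.
  by apply: sup_norm_le => x; rewrite [leLHS]rnormB; exact: (close f _ e4 Ff x).
have := rnormD (BFct bh - f) (f - g); rewrite addrA subrK; lra.
Qed.

HB.instance Definition _ := Uniform_isComplete.Build bfct bfct_complete.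

End SupNorm.

(** * Continuity and Riemann sums for Haar measure *)

Section ComplexContinuity.
Variables (R : realType) (T : topologicalType).
Implicit Types f g : T -> R[i]^o.

Lemma continuous_ReIm f : continuous f <->
  continuous (fun x => complex.Re (f x) : R) /\
  continuous (fun x => complex.Im (f x) : R).
Proof.
split=> [fc|[cR cI] x].
  split=> x; apply/cvgrPdist_lt => e e0.
    have e0' : 0 < e%:C by rewrite ltcR.
    have /cvgrPdist_lt/(_ _ e0') := fc x.
    apply: filterS => y; rewrite -raddfB -rnormE ltcR.
    exact: le_lt_trans (normr_Re _).
  have e0' : 0 < e%:C by rewrite ltcR.
  have /cvgrPdist_lt/(_ _ e0') := fc x.
  apply: filterS => y; rewrite -raddfB -rnormE ltcR.
  exact: le_lt_trans (normr_Im _).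
apply/cvgrPdist_lt => -[e e']; rewrite ltcE /= => /andP[/eqP -> {e'} e0].
have e2 : 0 < e / 2 by rewrite divr_gt0.
have /cvgrPdist_lt/(_ _ e2) cRx := cR x.
have /cvgrPdist_lt/(_ _ e2) cIx := cI x.
near=> y; rewrite -rnormE ltcR (le_lt_trans (rnorm_le_ReIm _))// [e]splitr.
by rewrite !raddfB ltrD//; near: y.
Unshelve. all: by end_near. Qed.

Lemma continuous_cstC (a : R[i]^o) : continuous (fun _ : T => a).
Proof. by move=> x; apply: (@cst_continuous T R[i]^o). Qed.

Lemma continuous_mulC f g : continuous f -> continuous g ->
  continuous (fun x => f x * g x : R[i]^o).
Proof.
move=> /continuous_ReIm[fR fI] /continuous_ReIm[gR gI]; apply/continuous_ReIm.
split.
  rewrite (_ : (fun _ => _) = fun x => complex.Re (f x) * complex.Re (g x) -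
    complex.Im (f x) * complex.Im (g x)); last by apply/funext => x; rewrite cReM.
  by move=> x; apply: cvgB; apply: cvgM; [exact: fR|exact: gR|exact: fI|exact: gI].
rewrite (_ : (fun _ => _) = fun x => complex.Re (f x) * complex.Im (g x) +
  complex.Im (f x) * complex.Re (g x)); last by apply/funext => x; rewrite cImM.
by move=> x; apply: cvgD; apply: cvgM; [exact: fR|exact: gI|exact: fI|exact: gR].
Qed.

Lemma continuous_addC f g : continuous f -> continuous g ->
  continuous (fun x => f x + g x : R[i]^o).
Proof.
move=> /continuous_ReIm[fR fI] /continuous_ReIm[gR gI]; apply/continuous_ReIm.
split.
  rewrite (_ : (fun _ => _) = fun x => complex.Re (f x) + complex.Re (g x)).
    by move=> x; apply: cvgD; [exact: fR|exact: gR].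
  by apply/funext => x; rewrite cReD.
rewrite (_ : (fun _ => _) = fun x => complex.Im (f x) + complex.Im (g x)).
  by move=> x; apply: cvgD; [exact: fI|exact: gI].
by apply/funext => x; rewrite cImD.
Qed.

Lemma continuous_conjC f : continuous f -> continuous (fun x => conjc (f x) : R[i]^o).
Proof.
move=> /continuous_ReIm[fR fI]; apply/continuous_ReIm; split.
  rewrite (_ : (fun _ => _) = fun x => complex.Re (f x))//.
  by apply/funext => x; case: (f x).
rewrite (_ : (fun _ => _) = fun x => - complex.Im (f x)).
  by move=> x; apply: cvgN; exact: fI.
by apply/funext => x; case: (f x).
Qed.

Lemma continuous_rnorm f : continuous f -> continuous (fun x => rnorm (f x)).
Proof.
move=> fc x; apply/cvgrPdist_lt => e e0.
have e0' : 0 < e%:C by rewrite ltcR.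
have /cvgrPdist_lt/(_ _ e0') := fc x.
apply: filterS => y; rewrite -rnormE ltcR; apply: le_lt_trans.
have := rnormD (f x - f y) (f y); have := rnormD (f y - f x) (f x).
rewrite !subrK (rnormB (f y)) => h1 h2.
by rewrite ler_norml; apply/andP; split; lra.
Qed.

End ComplexContinuity.

(** Compactness as an induction principle for an ideal of sets. If the whole space were not in the
    ideal, the complements of its members would form a proper filter, and a cluster point of that
    filter would have no neighbourhood in the ideal. *)
Lemma compact_hereditary (T : topologicalType) (Q : set (set T)) :
  compact [set: T] -> Q set0 -> (forall A B, A `<=` B -> Q B -> Q A) ->
  (forall A B, Q A -> Q B -> Q (A `|` B)) ->
  (forall x : T, exists2 U, nbhs x U & Q U) -> Q setT.
Proof.
move=> cT Q0 Qsub QU Qloc; apply: contrapT => nQT.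
pose F : set_system T := [set X | Q (~` X)].
have FF : ProperFilter F.
  split; first by rewrite /F /= setC0.
  split.
  - by rewrite /F /= setCT.
  - by move=> A B QA QB; rewrite /F /= setCI; exact: QU.
  - by move=> A B AB; apply: Qsub; exact: subsetC.
have [x [_ xF]] := cT F FF filterT.
have [U Ux QUx] := Qloc x.
have FU : F (~` U) by rewrite /F /= setCK.
by have [y []] := xF _ _ FU Ux.
Qed.

Section Integration.
Variables (R : realType) (G : topologicalZmodType).
Hypothesis compactG : compact [set: G].
Variable mu : probability (borel G) R.
Implicit Types F : G -> R.

Lemma open_borel (U : set G) : open U -> measurable (U : set (borel G)).
Proof. by move=> oU; exact: sub_sigma_algebra. Qed.

Lemma measurable_continuous F : continuous F -> measurable_fun [set: borel G] F.
Proof.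
move=> Fc; apply: (measurability _ (RGenOInfty.measurableE R)).
move=> _ [_ [a ->] <-]; rewrite setTI; apply: open_borel.
by move/continuousP : Fc; apply; exact: interval_open.
Qed.

Lemma continuous_bounded F : continuous F -> exists M, forall x, `|F x| <= M.
Proof.
move=> Fc; have cF : {within [set: G], continuous F} by exact: continuous_subspaceT.
have /compact_bounded[M [Mreal FM]] := continuous_compact cF compactG.
by exists (M + 1) => x; apply: (FM (M + 1)); [rewrite ltrDl|exists x].
Qed.

Lemma integrable_continuous F (A : set (borel G)) : measurable A ->
  continuous F -> mu.-integrable A (EFin \o F).
Proof.
move=> mA Fc; apply: measurable_bounded_integrable => //.
- by rewrite (le_lt_trans (probability_le1 mu mA))// ltry.
- by apply: measurable_funTS; exact: measurable_continuous.
- have [M FM] := continuous_bounded Fc.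
  by exists M; split=> [|r Mr x _ /=]; rewrite ?num_real// (le_trans (FM x))// ltW.
Qed.

Lemma Rintegral_translate F g : is_haar mu -> continuous F ->
  \int[mu]_x F (g + x) = \int[mu]_x F x.
Proof.
move=> [inv _ _] Fc.
pose phi : borel G -> borel G := fun x => (g : G) + x.
have phic : continuous (fun x : G => g + x).
  move=> x; apply: (@continuous_comp _ _ _ (fun x : G => (g, x)) (fun p : G * G => p.1 + p.2)).
    by apply: cvg_pair; [exact: cvg_cst|exact: cvg_id].
  exact: add_continuous.
have mphi : measurable_fun setT phi.
  move=> mT B mB; rewrite setTI; move: B mB.
  apply: smallest_sub => [|U oU]; last first.
    by apply: open_borel; move/continuousP : phic; apply.
  split => [|B mB|Bs mBs].
  - by rewrite /= preimage_set0; exact: measurable0.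
  - by rewrite /= setTD preimage_setC; exact: measurableC.
  - by rewrite /= preimage_bigcup; exact: bigcupT_measurable.
congr fine; have FgC : continuous (fun x : G => F (g + x)).
  by move=> x; apply: continuous_comp; [exact: phic|exact: Fc].
transitivity (\int[pushforward mu phi]_y (F y)%:E)%E.
  rewrite integral_pushforward//.
  - by apply/measurable_EFinP; exact: measurable_continuous.
  - by rewrite preimage_setT; exact: (integrable_continuous _ FgC).
(* The preimage of [A] under translation by [g] is the translate of [A] by [- g]. *)
apply: eq_measure_integral => A mA _; apply: etrans (inv (- g) _ mA).
rewrite /= /pushforward; congr (mu _); apply/seteqP; split => x /=.
  by move=> Ax; exists (g + x) => //; rewrite addKr.
by case=> y Ay <-; rewrite /phi addNKr.
Qed.

(** One sample serves a finite family of kernels and all [x] simultaneously. Weights are measures of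
    the pieces of a partition on which the kernels vary little in [y]; they are nonnegative of sum
    1, so sampled averages are convex combinations. *)
Lemma riemann_sum (I : finType) (F : I -> G -> G -> R) (e : R) :
  (forall k, continuous (fun p : G * G => F k p.1 p.2)) -> 0 < e ->
  exists s : seq (R * G), [/\ forall p, p \in s -> 0 <= p.1,
    \sum_(p <- s) p.1 = 1 &
    forall k x, `|\sum_(p <- s) p.1 * F k x p.2 - \int[mu]_y F k x y| <= e].
Proof.
move=> Fc e0.
have Fxc k x : continuous (F k x).
  move=> y; apply: (@continuous_comp _ _ _ (fun y : G => (x, y)) (fun p : G * G => F k p.1 p.2)).
    by apply: cvg_pair; [exact: cvg_cst|exact: cvg_id].
  exact: Fc.
pose m (A : set G) : R := fine (mu (A : set (borel G))).
(* The error is made proportional to the measure of [A], so that it adds up over disjoint pieces. *)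
pose P (A : set G) := exists s : seq (R * G), [/\ forall p, p \in s -> 0 <= p.1,
    \sum_(p <- s) p.1 = m A &
    forall k x, `|\sum_(p <- s) p.1 * F k x p.2 - \int[mu]_(y in A) F k x y| <= e * m A].
(* Requiring [P] for all measurable subsets of [B'] makes the property stable under unions that are
   not disjoint: a set inside the union is cut into its part in [A'] and the rest. *)
pose Q (B : set G) := exists2 B', B `<=` B' & measurable (B' : set (borel G)) /\
  forall A, A `<=` B' -> measurable (A : set (borel G)) -> P A.
suff [B' TB' [_ /(_ setT TB' measurableT)]] : Q setT.
  by rewrite /P /m probability_setT /= mulr1.
apply: compact_hereditary => //.
- exists set0 => //; split=> [|A A0 _]; first exact: measurable0.
  have -> : A = set0 by rewrite -subset0.
  exists [::]; rewrite /m measure0 big_nil; split => // k x.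
  by rewrite big_nil Rintegral_set0 subrr normr0 mulr0.
- by move=> A B AB [B' BB' ?]; exists B' => //; exact: subset_trans BB'.
- move=> A B [A' AA' [mA' PA']] [B' BB' [mB' PB']].
  exists (A' `|` B'); first exact: setUSS.
  split=> [|C CAB mC]; first exact: measurableU.
  have mCA : measurable (C `&` A' : set (borel G)) by exact: measurableI.
  have mCD : measurable (C `\` A' : set (borel G)) by exact: measurableD.
  have [s [s0 s1 s2]] := PA' _ (@subIsetr _ _ _) mCA.
  have [t [t0 t1 t2]] : P (C `\` A').
    by apply: PB' => // x [Cx nAx]; have [|] := CAB _ Cx.
  have CE : C = (C `&` A') `|` (C `\` A') by rewrite setUIDK.
  have mE : m C = m (C `&` A') + m (C `\` A').
    rewrite /m {1}CE measureU//; last by rewrite -subset0 => y [[_ ?] []].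
    by rewrite fineD// fin_num_measure.
  exists (s ++ t); split.
  + by move=> p; rewrite mem_cat => /orP[/s0|/t0].
  + by rewrite big_cat /= s1 t1.
  + move=> k x; rewrite big_cat /= mE mulrDr {1}CE Rintegral_setU//.
    * by rewrite opprD addrACA (le_trans (ler_normD _ _))// lerD.
    * by apply: integrable_continuous; [rewrite -CE|exact: Fxc].
    * by apply/disj_setPS => y [[_ ?] []].
- move=> g.
  (* The tube lemma: compactness in [x] makes the neighbourhood of [g] independent of [x]. *)
  have near_g : \forall h \near g, forall k x, `|F k x g - F k x h| < e.
    have := (compact_near_coveringP _).1 compactG G (nbhs g)
      (fun h x => forall k, `|F k x g - F k x h| < e) _.
    have FI : Filter (nbhs g) by exact: nbhs_filter.
    move=> /(_ FI) near_covered.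
    suff /near_covered : forall x : G, setT x -> \forall x' \near x & h \near g,
        forall k, `|F k x' g - F k x' h| < e.
      by apply: filterS => h hx k x; exact: hx.
    move=> x _.
    have e2 : 0 < e / 2 by rewrite divr_gt0.
    suff : \forall q \near (x, g), forall k, `|F k q.1 g - F k q.1 q.2| < e by [].
    apply: (@filter_forall _ I
      (fun k (q : G * G) => `|F k q.1 g - F k q.1 q.2| < e) (nbhs (x, g))) => k.
    have /cvgrPdist_lt/(_ _ e2) c1 := Fc k (x, g).
    have c2 : \forall q \near (x, g), `|F k x g - F k q.1 g| < e / 2.
      have cx : continuous (fun y : G => F k y g).
        move=> y; apply: (@continuous_comp _ _ _ (fun y : G => (y, g)) (fun p : G * G => F k p.1 p.2)).
          by apply: cvg_pair; [exact: cvg_id|exact: cvg_cst].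
        exact: Fc.
      have /cvgrPdist_lt/(_ _ e2) := cx x.
      by move=> /(cvg_fst); apply.
    near=> q; rewrite [e]splitr -[F k q.1 g](subrK (F k x g)) -addrA.
    rewrite (le_lt_trans (ler_normD _ _))// ltrD//.
      by rewrite distrC; near: q.
    by near: q.
  have : nbhs g [set h | forall k x, `|F k x g - F k x h| < e] by exact: near_g.
  rewrite {1}nbhsE /= => -[U [oU Ug] Usub].
  exists U; first by rewrite nbhsE; exists U.
  exists U => //; split=> [|A AU mA]; first exact: open_borel.
  (* Where the kernels vary by less than [e], the single sample point [g] is enough, even when [g]
     is not in [A]. *)
  exists [:: (m A, g)]; split.
  + by move=> p; rewrite inE => /eqP -> /=; exact: fine_ge0.
  + by rewrite big_seq1.
  + move=> k x; rewrite big_seq1 /= mulrC /m -Rintegral_cst// -RintegralB//.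
    * apply: le_trans (le_normr_Rintegral _ _) _ => //.
        apply: (integrable_continuous mA) => y.
        by apply: cvgB; [exact: cvg_cst|exact: Fxc].
      rewrite -Rintegral_cst//; apply: le_Rintegral => //.
      - apply: (integrable_continuous mA) => y.
        by apply: cvg_norm; apply: cvgB; [exact: cvg_cst|exact: Fxc].
      - by apply: (integrable_continuous mA) => y; exact: cvg_cst.
      - by move=> y /AU /Usub/(_ k x)/ltW.
    * by apply: (integrable_continuous mA) => y; exact: cvg_cst.
    * exact: (integrable_continuous mA).
Unshelve. all: by end_near. Qed.

End Integration.

(** * Complex integrals and characters *)

Section ComplexIntegral.
Variables (R : realType) (G : topologicalZmodType).
Variable mu : probability (borel G) R.
Implicit Types f h : G -> R[i]^o.

Definition integrableC f :=
  mu.-integrable [set: borel G] (EFin \o (fun x => complex.Re (f x))) /\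
  mu.-integrable [set: borel G] (EFin \o (fun x => complex.Im (f x))).

Lemma integralC_eq f h : f =1 h -> integralC mu f = integralC mu h.
Proof. by move=> /funext ->. Qed.

Lemma integrableCD f h : integrableC f -> integrableC h ->
  integrableC (fun x => f x + h x).
Proof.
move=> [fR fI] [hR hI]; split.
  rewrite (_ : _ \o _ = (EFin \o (fun x => complex.Re (f x))) \+
    (EFin \o (fun x => complex.Re (h x))))%E; first exact: integrableD.
  by apply/funext => x; rewrite /= cReD EFinD.
rewrite (_ : _ \o _ = (EFin \o (fun x => complex.Im (f x))) \+
  (EFin \o (fun x => complex.Im (h x))))%E; first exact: integrableD.
by apply/funext => x; rewrite /= cImD EFinD.
Qed.

Lemma integralCD f h : integrableC f -> integrableC h ->
  integralC mu (fun x => f x + h x) = integralC mu f + integralC mu h.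
Proof.
move=> [fR fI] [hR hI]; apply/eqP; rewrite eq_complex /=; apply/andP; split.
  under eq_Rintegral do rewrite cReD.
  by rewrite RintegralD.
under eq_Rintegral do rewrite cImD.
by rewrite RintegralD.
Qed.

Lemma integrable_real_comb (a b : R) (u v : G -> R) :
  mu.-integrable [set: borel G] (EFin \o u) ->
  mu.-integrable [set: borel G] (EFin \o v) ->
  mu.-integrable [set: borel G] (EFin \o (fun x => a * u x + b * v x)) /\
  \int[mu]_x (a * u x + b * v x) = a * \int[mu]_x u x + b * \int[mu]_x v x.
Proof.
move=> iu iv.
have iau : mu.-integrable [set: borel G] (EFin \o (fun x => a * u x)).
  rewrite (_ : _ \o _ = fun x => a%:E * (EFin \o u) x)%E; first exact: integrableZl.
  by apply/funext => x /=; rewrite EFinM.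
have ibv : mu.-integrable [set: borel G] (EFin \o (fun x => b * v x)).
  rewrite (_ : _ \o _ = fun x => b%:E * (EFin \o v) x)%E; first exact: integrableZl.
  by apply/funext => x /=; rewrite EFinM.
split; last by rewrite RintegralD// !RintegralZl.
rewrite (_ : _ \o _ = (EFin \o (fun x => a * u x)%R) \+ (EFin \o (fun x => b * v x)%R))%E.
  exact: integrableD.
by apply/funext => x; rewrite /= EFinD.
Qed.

Lemma integralCZ (a : R[i]) f : integrableC f ->
  integrableC (fun x => a * f x) /\
  integralC mu (fun x => a * f x) = a * integralC mu f.
Proof.
move=> [fR fI].
have ER : (fun x => complex.Re (a * f x)) =
    fun x => complex.Re a * complex.Re (f x) + (- complex.Im a) * complex.Im (f x).
  by apply/funext => x; rewrite cReM mulNr.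
have EI : (fun x => complex.Im (a * f x)) =
    fun x => complex.Re a * complex.Im (f x) + complex.Im a * complex.Re (f x).
  by apply/funext => x; rewrite cImM.
have [iR eR] := integrable_real_comb (complex.Re a) (- complex.Im a) fR fI.
have [iI eI] := integrable_real_comb (complex.Re a) (complex.Im a) fI fR.
split; first by split; rewrite ?ER ?EI.
apply/eqP; rewrite eq_complex cReM cImM /=.
by rewrite ER EI eR eI mulNr !eqxx.
Qed.

Lemma integralC_sum I (r : seq I) (c : I -> R[i]) (f : I -> G -> R[i]^o) :
  (forall k, integrableC (f k)) ->
  integrableC (fun x => \sum_(k <- r) c k * f k x) /\
  integralC mu (fun x => \sum_(k <- r) c k * f k x) =
    \sum_(k <- r) c k * integralC mu (f k).
Proof.
move=> fi; elim: r => [|k r [ir er]].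
  have E0 : (fun x : G => \sum_(k <- [::]) c k * f k x) = fun=> 0 * 0 :> R[i]^o.
    by apply/funext => x; rewrite big_nil mul0r.
  have i0 : integrableC (fun=> 0 : R[i]^o) by split; exact: integrable0.
  have [i00 e00] := integralCZ 0 i0.
  by rewrite E0 big_nil; split; rewrite ?e00 ?mul0r.
have E : (fun x : G => \sum_(k <- k :: r) c k * f k x) =
    fun x => (c k * f k x : R[i]^o) + \sum_(k <- r) c k * f k x.
  by apply/funext => x; rewrite big_cons.
have [ik ek] := integralCZ (c k) (fi k).
rewrite E big_cons; split; first exact: integrableCD.
by rewrite integralCD// ek er.
Qed.

Hypothesis compactG : compact [set: G].

Lemma integrableC_continuous f : continuous f -> integrableC f.
Proof.
by move=> /continuous_ReIm[fR fI]; split; exact: integrable_continuous.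
Qed.

Lemma integralC_translate f g : is_haar mu -> continuous f ->
  integralC mu (fun x => f (g + x)) = integralC mu f.
Proof.
move=> haar /continuous_ReIm[fR fI]; rewrite /integralC.
congr Complex.
  exact: (@Rintegral_translate _ _ compactG mu (fun x => complex.Re (f x))).
exact: (@Rintegral_translate _ _ compactG mu (fun x => complex.Im (f x))).
Qed.

Lemma Rintegral_probability_cst (c : R) : \int[mu]_x c = c.
Proof.
rewrite Rintegral_cst// -[RHS]mulr1; congr (_ * _).
exact: (congr1 fine (probability_setT mu)).
Qed.

Lemma integralC_real (u : G -> R) :
  integralC mu (fun x => (u x)%:C) = (\int[mu]_x u x)%:C.
Proof.
rewrite /integralC /=; congr Complex.
exact: Rintegral_probability_cst.
Qed.

Lemma integralC_cst (a : R[i]) : integralC mu (fun=> a) = a.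
Proof.
by rewrite /integralC !Rintegral_probability_cst; case: a.
Qed.

(** The crude factor 2 comes from bounding real and imaginary parts separately; it never reaches a
    main term of the estimates. *)
Lemma rnorm_integralC f : continuous f -> f \in @bounded_fct R G ->
  rnorm (integralC mu f : R[i]^o) <= 2 * sup_norm f.
Proof.
move=> /continuous_ReIm[fR fI] bf; rewrite (le_trans (rnorm_le_ReIm _))//.
have bound (u : G -> R) : continuous u -> (forall x, `|u x| <= rnorm (f x)) ->
    `|\int[mu]_x u x| <= sup_norm f.
  move=> uc uf; apply: (@le_trans _ _ (\int[mu]_x `|u x|)).
    by apply: le_normr_Rintegral => //; exact: integrable_continuous.
  have -> : sup_norm f = \int[mu]_x (sup_norm f).
    by rewrite Rintegral_probability_cst.
  apply: le_Rintegral => //.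
  - by apply: integrable_continuous => // x; apply: cvg_norm; exact: uc.
  - by apply: integrable_continuous => // x; exact: cvg_cst.
  - by move=> x _; rewrite (le_trans (uf x))// sup_norm_ub.
rewrite /= mulr_natl mulr2n lerD// bound// => x; [exact: normr_Re|exact: normr_Im].
Qed.

Lemma riemann_sumC (I : finType) (F : I -> G -> G -> R[i]^o) (e : R) :
  (forall k, continuous (fun p : G * G => F k p.1 p.2)) -> 0 < e ->
  exists s : seq (R * G), [/\ forall p, p \in s -> 0 <= p.1,
    \sum_(p <- s) p.1 = 1 &
    forall k x, rnorm (\sum_(p <- s) p.1%:C * F k x p.2
      - integralC mu (F k x) : R[i]^o) <= e].
Proof.
move=> Fc e0.
pose F' (k : I * bool) x y := if k.2 then complex.Re (F k.1 x y) else complex.Im (F k.1 x y).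
have F'c k : continuous (fun p : G * G => F' k p.1 p.2).
  by rewrite /F'; have [? ?] := (continuous_ReIm _).1 (Fc k.1); case: k.2.
have [|s [s0 s1 sF]] := riemann_sum compactG mu F'c (e := e / 2).
  by rewrite divr_gt0.
exists s; split => // k x; rewrite (le_trans (rnorm_le_ReIm _))// [e]splitr.
rewrite !raddfB !raddf_sum /= lerD//.
  under eq_bigr do rewrite Re_realM.
  exact: (sF (k, true)).
under eq_bigr do rewrite Im_realM.
exact: (sF (k, false)).
Qed.

End ComplexIntegral.

Section Characters.
Variables (R : realType) (G : topologicalZmodType).
Implicit Types f h : G -> R[i]^o.

Lemma rnorm_dual gamma x : dual_group R G gamma -> rnorm (gamma x) = 1.
Proof. by case=> _ g1 _; rewrite /rnorm g1. Qed.

Lemma dual_neq0 gamma x : dual_group R G gamma -> gamma x != 0.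
Proof.
move=> dg; apply/eqP => g0; have := rnorm_dual x dg.
by rewrite g0 rnorm0 => /eqP; rewrite eq_sym oner_eq0.
Qed.

Lemma dual0 gamma : dual_group R G gamma -> gamma 0 = 1.
Proof.
move=> dg; have [_ _ gM] := dg; have := gM 0 0; rewrite addr0.
move/(congr1 (fun z => z / gamma 0)); rewrite mulfK ?dual_neq0//.
by rewrite divff ?dual_neq0.
Qed.

Lemma dualJ gamma x : dual_group R G gamma -> conjc (gamma x) = gamma (- x).
Proof.
move=> dg; have [_ _ gM] := dg; apply: (mulfI (dual_neq0 x dg)).
by rewrite mulrJ_rnorm rnorm_dual// -gM subrr dual0// expr1n.
Qed.

Variable mu : probability (borel G) R.
Hypotheses (compactG : compact [set: G]) (haar : is_haar mu).

Lemma continuous_fct_bounded f : continuous f -> f \in @bounded_fct R G.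
Proof.
move=> fc; apply/bounded_fctP.
have [M FM] := continuous_bounded compactG (continuous_rnorm fc).
by exists M => x; rewrite (le_trans (ler_norm _) (FM x)).
Qed.

Lemma continuous_translate g f : continuous f -> continuous (translate g f).
Proof.
move=> fc x; apply: continuous_comp; last exact: fc.
apply: (@continuous_comp _ _ _ (fun x : G => (- g, x)) (fun p : G * G => p.1 + p.2)).
  by apply: cvg_pair; [exact: cvg_cst|exact: cvg_id].
exact: add_continuous.
Qed.

Lemma continuous_comb (a : R[i]) f h : continuous f -> continuous h ->
  continuous (a *: f + h).
Proof.
move=> fc hc; have E : a *: f + h = fun x => (a * f x : R[i]^o) + h x by [].
have ac := @continuous_cstC R G a.
have afc := continuous_mulC ac fc.
by rewrite E; exact: continuous_addC afc hc.
Qed.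

Lemma continuous_sum I (r : seq I) (c : I -> R[i]) (f : I -> G -> R[i]^o) :
  (forall k, continuous (f k)) -> continuous (\sum_(k <- r) c k *: f k).
Proof.
move=> fc; elim: r => [|k r IH].
  by rewrite big_nil; exact: continuous_cstC.
by rewrite big_cons; exact: (continuous_comb (fc k) IH).
Qed.

Lemma L2_inner_translate gamma g f : dual_group R G gamma -> continuous f ->
  L2_inner mu (translate g f) gamma = conjc (gamma g) * L2_inner mu f gamma.
Proof.
move=> dg fc; have [gc _ gM] := dg.
have fgc : continuous (fun x => f x * conjc (gamma x) : R[i]^o).
  exact: (continuous_mulC fc (continuous_conjC gc)).
have fgi := integrableC_continuous mu compactG fgc.
rewrite /L2_inner -(integralCZ _ fgi).2.
rewrite -(integralC_translate compactG g haar); last first.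
  exact: (continuous_mulC (continuous_translate fc) (continuous_conjC gc)).
apply: integralC_eq => x; rewrite /translate addKr gM rmorphM /=.
by rewrite mulrCA.
Qed.

Lemma L2_inner_comb (gamma : G -> R[i]^o) (a : R[i]) f h :
  continuous gamma -> continuous f -> continuous h ->
  L2_inner mu (a *: f + h) gamma = a * L2_inner mu f gamma + L2_inner mu h gamma.
Proof.
move=> gc fc hc.
have ci (u : G -> R[i]^o) : continuous u -> integrableC mu (fun x => u x * conjc (gamma x)).
  move=> uc; apply: (integrableC_continuous mu compactG).
  exact: (continuous_mulC uc (continuous_conjC gc)).
have [ia ea] := integralCZ a (ci _ fc).
rewrite /L2_inner -ea -integralCD//; last exact: ci.
by apply: integralC_eq => x; rewrite mulrDl mulrA.
Qed.

(** Translating [gamma] by [- g] multiplies the inner product by [gamma g], by homogeneity, and by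
    [gamma' g], by invariance of the measure. A nonzero inner product therefore forces the
    characters to agree at every [g]. *)
Lemma L2_inner_dual gamma gamma' : dual_group R G gamma -> dual_group R G gamma' ->
  L2_inner mu gamma gamma' = (gamma == gamma')%:R.
Proof.
move=> dg dg'; have [gc _ gM] := dg.
have [<-|neq] := eqVneq gamma gamma'.
  rewrite /L2_inner; under [X in integralC mu X]funext do
    rewrite mulrJ_rnorm rnorm_dual// expr1n.
  exact: integralC_cst.
apply/eqP/negPn/negP => I0; move/eqP: neq; apply; apply/funext => g.
have c0 : continuous (0 : G -> R[i]^o) := @continuous_cstC R G 0.
have E : translate (- g) gamma = gamma g *: gamma + 0.
  by apply/funext => x; rewrite /translate opprK gM addr0.
have [gc' _ _] := dg'.
have := L2_inner_translate (- g) dg' gc; rewrite E (L2_inner_comb _ gc' gc c0).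
rewrite dualJ// opprK.
have -> : L2_inner mu 0 gamma' = 0.
  by rewrite /L2_inner; under [X in integralC mu X]funext do rewrite mul0r; exact: integralC_cst.
by rewrite addr0; exact: mulIf.
Qed.

End Characters.

(** * Fourier coefficients on the span of finitely many characters *)

Section Span.
Variables (R : realType) (V : lmodType R[i]).

Lemma lin_span_min (A X : set V) : X 0 ->
  (forall a u v, X u -> X v -> X (a *: u + v)) -> A `<=` X -> lin_span A `<=` X.
Proof.
move=> X0 Xlin AX _ [n [c [b [bA ->]]]].
by elim/big_rec: _ => // k v _ Xv; apply: Xlin => //; apply/AX/bA.
Qed.

Lemma lin_span_mem (A : set V) v : A v -> lin_span A v.
Proof.
move=> Av; exists 1, (fun=> 1), (fun=> v); split=> //.
by rewrite big_ord1 scale1r.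
Qed.

Lemma lin_span_rangeP n (b : 'I_n -> V) v :
  lin_span (range b) v <-> exists c : 'I_n -> R[i], v = \sum_(k < n) c k *: b k.
Proof.
split=> [|[c ->]]; last by exists n, c, b; split => // k; exists k.
apply: (@lin_span_min _ [set v | exists c : 'I_n -> R[i], v = \sum_(k < n) c k *: b k]).
- by exists (fun=> 0); rewrite big1// => k _; rewrite scale0r.
- move=> a _ _ [c ->] [d ->]; exists (fun k => a * c k + d k).
  rewrite scaler_sumr -big_split /=; apply: eq_bigr => k _.
  by rewrite scalerDl scalerA.
- move=> _ [k _ <-]; exists (fun l => (l == k)%:R).
  rewrite (bigD1 k)//= eqxx scale1r big1 ?addr0// => l /negbTE ->.
  by rewrite scale0r.
Qed.

Lemma lin_span_range0 n (b : 'I_n -> V) : lin_span (range b) 0.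
Proof.
by apply/lin_span_rangeP; exists (fun=> 0); rewrite big1// => k _; rewrite scale0r.
Qed.

Lemma lin_span_range_lin n (b : 'I_n -> V) a u v :
  lin_span (range b) u -> lin_span (range b) v -> lin_span (range b) (a *: u + v).
Proof.
move=> /lin_span_rangeP[c ->] /lin_span_rangeP[d ->]; apply/lin_span_rangeP.
exists (fun k => a * c k + d k).
rewrite scaler_sumr -big_split /=; apply: eq_bigr => k _.
by rewrite scalerDl scalerA.
Qed.

End Span.

Lemma finite_set_enum (T : choiceType) (A : set T) : finite_set A ->
  exists n (b : 'I_n -> T), [/\ injective b, A = range b &
    forall (V : nmodType) (F : T -> V),
      \sum_(x \in A) F x = \sum_(k < n) F (b k)].
Proof.
move=> /finite_seqP[r ->]; pose s := undup r.
have us : uniq s by exact: undup_uniq.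
have -> : [set` r] = [set` s].
  by apply/seteqP; split => x; rewrite /= mem_undup.
exists (size s), (fun k => tnth (in_tuple s) k); split.
- move=> k l; have [x0] : exists x0 : T, True by exists (tnth (in_tuple s) k).
  rewrite !(tnth_nth x0) => _ /eqP.
  by rewrite nth_uniq// => /eqP/val_inj.
- apply/seteqP; split => [x /= xs|_ [k _ <-]]; last exact: mem_tnth.
  by have /(tnthP (in_tuple s))[k ->] := xs; exists k.
- by move=> V F; rewrite -fsbig_seq// (big_tnth _ _ s).
Qed.

Section Fourier.
Variables (R : realType) (G : topologicalZmodType).
Variable mu : probability (borel G) R.
Hypotheses (compactG : compact [set: G]) (haar : is_haar mu).
Variables (n : nat) (b : 'I_n -> G -> R[i]^o).
Hypotheses (b_inj : injective b) (b_dual : forall k, dual_group R G (b k)).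
Implicit Types f h : G -> R[i]^o.

Let bc k : continuous (b k). Proof. by case: (b_dual k). Qed.

Lemma L2_inner_comb_dual (c : 'I_n -> R[i]) k :
  L2_inner mu (\sum_(l < n) c l *: b l) (b k) = c k.
Proof.
have [_ e] := integralC_sum (index_enum 'I_n) c (fun l =>
  integrableC_continuous mu compactG
    (continuous_mulC (@bc l) (continuous_conjC (@bc k)))).
rewrite (_ : L2_inner _ _ _ = integralC mu (fun x => \sum_(l < n) c l * (b l x * conjc (b k x)))).
  have I l : integralC mu (fun x => b l x * conjc (b k x)) = (l == k)%:R.
    by rewrite -(inj_eq b_inj) -(L2_inner_dual compactG haar (b_dual l) (b_dual k)).
  rewrite e (bigD1 k)//= big1 => [|l /negbTE lk].
    by rewrite addr0 I eqxx mulr1.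
  by rewrite I lk mulr0.
apply: integralC_eq => x; rewrite fct_sumE mulr_suml.
by apply: eq_bigr => l _; rewrite mulrA.
Qed.

Lemma fourier_expansion s : lin_span (range b) s ->
  s = \sum_(k < n) L2_inner mu s (b k) *: b k.
Proof.
move=> /lin_span_rangeP[c ->]; apply: eq_bigr => k _.
by rewrite L2_inner_comb_dual.
Qed.

Lemma span_dual_continuous s : lin_span (range b) s -> continuous s.
Proof. by move=> /lin_span_rangeP[c ->]; exact: (continuous_sum bc). Qed.

(* With [y = g + x], the convolution [int gamma (- g) f (g + x) dg] equals
   [gamma x] times the Fourier coefficient of [f] at [gamma]. *)
Lemma fourier_riemann_sum f (e : R) : continuous f -> 0 < e ->
  exists s : seq (R * G), [/\ forall p, p \in s -> 0 <= p.1,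
    \sum_(p <- s) p.1 = 1 & forall k x,
    rnorm (\sum_(p <- s) (p.1%:C * b k (- p.2)) * translate (- p.2) f x
      - L2_inner mu f (b k) * b k x : R[i]^o) <= e].
Proof.
move=> fc e0.
pose F k x g : R[i]^o := b k (- g) * f (g + x).
have addc : continuous (fun p : G * G => p.2 + p.1).
  move=> p; apply: (@continuous_comp _ _ _ (fun p : G * G => (p.2, p.1))
    (fun p : G * G => p.1 + p.2)).
    by apply: cvg_pair; [exact: cvg_snd|exact: cvg_fst].
  exact: add_continuous.
have Fc k : continuous (fun p : G * G => F k p.1 p.2).
  have c1 : continuous (fun p : G * G => b k (- p.2)).
    move=> p.
    apply: (@continuous_comp _ _ _ (fun p : G * G => - p.2) (b k)); last exact: bc.
    apply: (@continuous_comp _ _ _ snd -%R); first exact: cvg_snd.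
    exact: opp_continuous.
  have c2 : continuous (fun p : G * G => f (p.2 + p.1)).
    move=> p.
    by apply: (@continuous_comp _ _ _ (fun p : G * G => p.2 + p.1) f); [exact: addc|exact: fc].
  exact: (continuous_mulC c1 c2).
have [s [s0 s1 sF]] := riemann_sumC mu compactG Fc e0.
exists s; split => // k x; apply: le_trans (sF k x).
have [_ _ gM] := b_dual k.
have <- : integralC mu (F k x) = L2_inner mu f (b k) * b k x.
  have fbc := continuous_mulC fc (continuous_conjC (@bc k)).
  have ibc := integrableC_continuous mu compactG fbc.
  have xfbc := continuous_mulC (@continuous_cstC R G (b k x)) fbc.
  rewrite mulrC -(integralCZ (b k x) ibc).2.
  rewrite -(integralC_translate compactG x haar xfbc).
  apply: integralC_eq => g; rewrite /F [x + g]addrC mulrCA mulrC; congr (_ * _).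
  by rewrite (dualJ _ (b_dual k)) -gM opprD addrCA subrr addr0.
rewrite le_eqVlt; apply/orP; left; apply/eqP; congr (rnorm (_ - _)).
by apply: eq_bigr => p _; rewrite /F /translate opprK mulrA.
Qed.

(** Stands in for the integral of [b k (- g) * L (translate (- g) f)] over [g]: the finite
    combination of translates is within [e] of a multiple of [b k] in supremum norm, and [L] is
    linear and bounded. Nothing is asked of how [L (translate (- g) f)] depends on [g]. *)
Lemma fourier_average (L : (G -> R[i]^o) -> R[i]^o) (M : R) f (e : R) :
  (forall a f h, continuous f -> continuous h -> L (a *: f + h) = a * L f + L h) ->
  0 <= M -> (forall f, continuous f -> rnorm (L f) <= M * sup_norm f) ->
  continuous f -> forall s : seq (R * G), forall k,
    (forall x, rnorm (\sum_(p <- s) (p.1%:C * b k (- p.2)) * translate (- p.2) f x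
      - L2_inner mu f (b k) * b k x : R[i]^o) <= e) ->
    rnorm (\sum_(p <- s) (p.1%:C * b k (- p.2)) * L (translate (- p.2) f)
      - L2_inner mu f (b k) * L (b k) : R[i]^o) <= M * e.
Proof.
move=> Llin M0 LM fc s k sk.
have c0 : continuous (0 : G -> R[i]^o) := @continuous_cstC R G 0.
have L0 : L 0 = 0.
  by have := Llin (-1) 0 0 c0 c0; rewrite scaler0 addr0 mulN1r addNr.
pose T (p : R * G) := translate (- p.2) f.
pose w (p : R * G) : R[i] := p.1%:C * b k (- p.2).
have Tc p : continuous (T p) := continuous_translate fc.
have Lsum (r : seq (R * G)) : L (\sum_(p <- r) w p *: T p) = \sum_(p <- r) w p * L (T p).
  elim: r => [|p r IH]; first by rewrite !big_nil.
  by rewrite !big_cons (Llin _ _ _ (Tc p) (continuous_sum Tc)) IH.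
pose u : G -> R[i]^o := \sum_(p <- s) w p *: T p.
have uc : continuous u := continuous_sum Tc.
pose v : G -> R[i]^o := (- L2_inner mu f (b k)) *: b k + u.
have vc : continuous v := continuous_comb (@bc k) uc.
have <- : L v = \sum_(p <- s) w p * L (T p) - L2_inner mu f (b k) * L (b k).
  by rewrite /v (Llin _ _ _ (@bc k) uc) Lsum addrC mulNr.
apply: le_trans (LM _ vc) _; rewrite ler_wpM2l//; apply: sup_norm_le => x.
apply: le_trans (sk x); rewrite le_eqVlt; apply/orP; left; apply/eqP.
congr rnorm; rewrite [RHS]addrC -mulNr.
by rewrite /v /u; congr (_ + _); rewrite fct_sumE.
Qed.

(** Let [L h] be the k-th Fourier coefficient of [Q h]. By equivariance each
    [b k (- p.2) * L (translate (- p.2) f)] equals [L f], so averaging over a sample changes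
    nothing; yet the average is close to the coefficient of [f] times [L (b k)], which is 1 because
    [Q] fixes [b k]. *)
Lemma equivariant_projection_fourier S Q f : S = lin_span (range b) ->
  equivariant_projection S Q -> continuous f ->
  Q f = \sum_(k < n) L2_inner mu f (b k) *: b k.
Proof.
move=> SE [Qlin [M QM] QS Qid Qeq] fc.
have Qc h : continuous h -> continuous (Q h).
  by move=> hc; apply: span_dual_continuous; rewrite -SE; exact: QS.
rewrite [LHS]fourier_expansion; last by rewrite -SE; exact: QS.
apply: eq_bigr => k _; congr (_ *: _).
pose L h : R[i]^o := L2_inner mu (Q h) (b k).
have Llin a h h' : continuous h -> continuous h' -> L (a *: h + h') = a * L h + L h'.
  move=> hc hc'; rewrite /L (Qlin _ _ _ hc hc').
  exact: (L2_inner_comb mu compactG _ (@bc k) (Qc _ hc) (Qc _ hc')).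
have LM h : continuous h -> rnorm (L h) <= (2 * `|M|) * sup_norm h.
  move=> hc.
  have Qhb := continuous_mulC (Qc _ hc) (continuous_conjC (@bc k)).
  apply: le_trans (rnorm_integralC mu compactG Qhb (continuous_fct_bounded compactG Qhb)) _.
  rewrite -mulrA ler_wpM2l//; apply: (@le_trans _ _ (sup_norm (Q h))).
    apply: sup_norm_le => x; rewrite rnormM rnormJ (rnorm_dual x (b_dual k)) mulr1.
    exact: (sup_norm_ub x (continuous_fct_bounded compactG (Qc _ hc))).
  apply: le_trans (QM _ hc) _; apply: ler_wpM2r (ler_norm M).
  exact: (sup_norm_ge0 (continuous_fct_bounded compactG hc)).
have M0 : 0 <= 2 * `|M| by rewrite mulr_ge0.
suff : rnorm (L f - L2_inner mu f (b k) : R[i]^o) <= 0.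
  move=> le0; apply/eqP; rewrite -subr_eq0; apply/eqP.
  by apply: (@rnorm_eq0 _ R[i]^o); apply/le_anti; rewrite le0 rnorm_ge0.
apply/ler_addgt0Pl => e e0; rewrite addr0.
(* Chosen so that [2 * |M| * e' <= e]; the [+ 1] covers [M = 0]. *)
pose e' := e / (2 * `|M| + 1).
have e'0 : 0 < e' by rewrite divr_gt0// ltr_wpDl.
have [s [s0 s1 sF]] := fourier_riemann_sum fc e'0.
have := fourier_average Llin M0 LM fc (sF k).
have -> : L (b k) = 1.
  have Sb : S (b k) by rewrite SE; apply: lin_span_mem; exists k.
  by rewrite /L (Qid _ Sb) (L2_inner_dual compactG haar (b_dual k) (b_dual k)) eqxx.
have -> : \sum_(p <- s) (p.1%:C * b k (- p.2)) * L (translate (- p.2) f) = L f.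
  transitivity (\sum_(p <- s) p.1%:C * L f); last first.
    by rewrite -mulr_suml -rmorph_sum s1 mul1r.
  apply: eq_bigr => p _.
  rewrite /L (Qeq _ _ fc) (L2_inner_translate compactG haar _ (b_dual k) (Qc _ fc)).
  rewrite -mulrA [b k _ * _]mulrA mulrJ_rnorm (rnorm_dual _ (b_dual k)) expr1n.
  by rewrite mul1r.
rewrite mulr1 => /le_trans; apply; rewrite /e' mulrCA.
apply: ler_piMr; first exact: ltW.
by rewrite ler_pdivrMr ?mul1r ?ltr_wpDl// lerDl.
Qed.

End Fourier.

(** * The orthogonal projection and the lower bound *)

Section L2.
Variables (R : realType) (G : topologicalZmodType).
Variable mu : probability (borel G) R.
Hypothesis compactG : compact [set: G].
Implicit Types f h : G -> R[i]^o.

Lemma integrableC_mul f u : integrableC mu f -> continuous u ->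
  integrableC mu (fun x => f x * u x).
Proof.
move=> [fR fI] /continuous_ReIm[uR uI].
have mul (v w : G -> R) : mu.-integrable [set: borel G] (EFin \o v) ->
    continuous w -> mu.-integrable [set: borel G] (EFin \o (fun x => v x * w x)).
  move=> vi wc; rewrite (_ : _ \o _ = (EFin \o v) \* (EFin \o w))%E; last first.
    by apply/funext => x /=; rewrite EFinM.
  apply: integrableMl => //; first exact: measurable_continuous.
  have [M wM] := continuous_bounded compactG wc.
  by exists M; split=> [|r Mr x _ /=]; rewrite ?num_real// (le_trans (wM x))// ltW.
have [RR II] := (mul _ _ fR uR, mul _ _ fI uI).
have [RI IR] := (mul _ _ fR uI, mul _ _ fI uR).
have [iR _] := integrable_real_comb 1 (-1) RR II.
have [iI _] := integrable_real_comb 1 1 RI IR.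
split.
  rewrite (_ : (fun x => complex.Re _) = fun x => 1 * (complex.Re (f x) * complex.Re (u x)) +
    (-1) * (complex.Im (f x) * complex.Im (u x)))//.
  by apply/funext => x; rewrite cReM mul1r mulN1r.
rewrite (_ : (fun x => complex.Im _) = fun x => 1 * (complex.Re (f x) * complex.Im (u x)) +
  1 * (complex.Im (f x) * complex.Re (u x)))//.
by apply/funext => x; rewrite cImM !mul1r.
Qed.

(** On a probability space the function [t ^+ 2 + 1] is integrable together with [t ^+ 2], and it
    dominates [t]. *)
Lemma integrableC_L2 f : L2_functions mu f -> integrableC mu f.
Proof.
move=> [mR mI fin].
have isq : mu.-integrable [set: borel G] (EFin \o (fun x => rnorm (f x) ^+ 2)).
  apply/integrableP; split.
    apply/measurable_EFinP.
    rewrite (_ : (fun x => _) = (fun x => complex.Re (f x) ^+ 2) \+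
      (fun x => complex.Im (f x) ^+ 2)).
      by apply: measurable_funD; exact: measurable_funX.
    by apply/funext => x; rewrite rnorm_sqr.
  by under eq_integral do rewrite /= ger0_norm ?sqr_ge0//.
have i1 : mu.-integrable [set: borel G] (EFin \o (fun=> 1 : R)).
  by apply: (integrable_continuous compactG) => // x; exact: cvg_cst.
have [ig _] := integrable_real_comb 1 1 isq i1.
have dom (u : G -> R) : measurable_fun [set: borel G] u ->
    (forall x, `|u x| <= rnorm (f x)) -> mu.-integrable [set: borel G] (EFin \o u).
  move=> mu_ uf; apply: le_integrable ig => //; first exact/measurable_EFinP.
  move=> x _; rewrite /= lee_fin !mul1r.
  rewrite [leRHS]ger0_norm ?addr_ge0 ?sqr_ge0//.
  apply: (le_trans (uf x)); move: (rnorm (f x)) => t.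
  by have := sqr_ge0 (t - 1); have := sqr_ge0 t; rewrite sqrrB1; lra.
by split; apply: dom => // x; [exact: normr_Re|exact: normr_Im].
Qed.

Hypothesis haar : is_haar mu.
Variables (n : nat) (b : 'I_n -> G -> R[i]^o).
Hypotheses (b_inj : injective b) (b_dual : forall k, dual_group R G (b k)).

Lemma L2_orthogonal_projection_fourier : L2_orthogonal_projection mu (lin_span (range b))
  (fun f => \sum_(k < n) L2_inner mu f (b k) *: b k).
Proof.
move=> f fL2; have fi := integrableC_L2 fL2.
have bc k : continuous (b k) by case: (b_dual k).
set Pf := \sum_(k < n) _.
split; first by apply/lin_span_rangeP; exists (fun k => L2_inner mu f (b k)).
move=> s /lin_span_rangeP[c ->].
have Pfc : continuous Pf := continuous_sum bc.
have bJc k := continuous_conjC (bc k).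
pose h k x := f x * conjc (b k x) + (-1) * (Pf x * conjc (b k x)).
have fbi k := integrableC_mul fi (bJc k).
have Pbi k := integrableC_continuous mu compactG (continuous_mulC Pfc (bJc k)).
have NPbi k := integralCZ (-1) (Pbi k).
have hi k : integrableC mu (h k) := integrableCD (fbi k) (NPbi k).1.
have h0 k : integralC mu (h k) = 0.
  rewrite /h (integralCD (fbi k) (NPbi k).1) (NPbi k).2 mulN1r.
  by rewrite [X in _ - X](L2_inner_comb_dual compactG haar b_inj b_dual) subrr.
have [_ e] := integralC_sum (index_enum 'I_n) (fun k => conjc (c k)) hi.
transitivity (integralC mu (fun x => \sum_(k < n) conjc (c k) * h k x)).
  apply: integralC_eq => x; rewrite fct_sumE rmorph_sum mulr_sumr.
  apply: eq_bigr => k _; rewrite /h mulN1r -mulrBl /=.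
  have -> : conjc ((c k *: b k) x) = conjc (c k) * conjc (b k x) by exact: rmorphM.
  by rewrite mulrCA.
by rewrite e big1// => k _; rewrite h0 mulr0.
Qed.

End L2.

Section ProjectionConstant.
Variables (R : realType) (G : topologicalZmodType).
Variable mu : probability (borel G) R.
Hypotheses (compactG : compact [set: G]) (haar : is_haar mu).
Variables (n : nat) (b : 'I_n -> G -> R[i]^o).
Hypotheses (b_inj : injective b) (b_dual : forall k, dual_group R G (b k)).
Implicit Types f h : G -> R[i]^o.

Let bc k : continuous (b k). Proof. by case: (b_dual k). Qed.
Let S := lin_span (range b).
Let D x : R[i]^o := \sum_(k < n) b k x.
Let K : R := \int[mu]_x rnorm (D x).

Let Dc : continuous D.
Proof.
rewrite (_ : D = \sum_(k < n) 1 *: b k); first exact: (continuous_sum bc).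
by apply/funext => x; rewrite fct_sumE; apply: eq_bigr => k _; rewrite scale1r.
Qed.

Lemma opnorm_bound (Y : normedModType R[i]) (P : {linear Y -> Y}) (r : R) :
  opnorm P = r%:E -> forall y, rnorm (P y) <= r * rnorm y.
Proof.
move=> Pr y; have [->|y0] := eqVneq y 0; first by rewrite linear0 rnorm0 mulr0.
have n0 : 0 < rnorm y.
  rewrite lt_neqAle rnorm_ge0 andbT eq_sym; apply: contraNneq y0 => /rnorm_eq0 ->//.
pose y' := (rnorm y)^-1%:C *: y.
have y'1 : rnorm y' = 1.
  by rewrite rnormZ rnorm_real gtr0_norm ?invr_gt0// mulVf// gt_eqF.
have yE : y = (rnorm y)%:C *: y'.
  by rewrite scalerA -rmorphM mulfV ?gt_eqF// scale1r.
rewrite {1}yE linearZ rnormZ rnorm_real gtr0_norm// mulrC ler_pM2r//.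
rewrite -lee_fin -Pr; apply: ereal_sup_ubound; exists y' => //=.
by rewrite -rnormE y'1.
Qed.

Lemma opnorm_ge0 (Y : normedModType R[i]) (P : {linear Y -> Y}) : (0 <= opnorm P)%E.
Proof.
by apply: ereal_sup_ubound; exists 0; rewrite /= ?normr0 ?ler01// linear0 rnorm0.
Qed.

Section Projection.
Variables (P : {linear bfct R G -> bfct R G}) (r : R).
Hypothesis Pr : forall y, rnorm (P y) <= r * rnorm y.
Hypothesis PS : forall y, S (bfct_val (P y)).
Hypothesis Pid : forall y, S (bfct_val y) -> P y = y.

(** Takes the default value 0 on unbounded functions, so that it is total; [jK] covers the
    continuous ones. *)
Let j f : bfct R G := insubd (0 : bfct R G) f.
Let jK f : continuous f -> bfct_val (j f) = f.
Proof. by move=> fc; rewrite /j [LHS]insubdK//; exact: (continuous_fct_bounded compactG fc). Qed.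

(** The sum of the Fourier coefficients is the value at 0 of the convolution of [f] with [D], hence
    of the average of [P] over translations applied to [f]. Every conjugate of [P] by a translation
    has the same bound [r]. *)
Lemma projection_fourier_bound f : 0 <= r -> continuous f -> sup_norm f <= 1 ->
  complex.Re (\sum_(k < n) L2_inner mu f (b k)) <= r.
Proof.
move=> r0 fc f1.
pose L k h : R[i]^o := L2_inner mu (bfct_val (P (j h))) (b k).
have Pc h : continuous (bfct_val (P (j h))).
  exact: (span_dual_continuous b_dual (PS _)).
have jlin a h h' : continuous h -> continuous h' -> j (a *: h + h') = a *: j h + j h'.
  move=> hc hc'; apply: val_inj; rewrite /= (jK (continuous_comb hc hc')).
  by rewrite (jK hc) (jK hc').
have Llin k a h h' : continuous h -> continuous h' -> L k (a *: h + h') = a * L k h + L k h'.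
  move=> hc hc'; rewrite /L (jlin _ _ _ hc hc') linearP.
  exact: (L2_inner_comb mu compactG a (@bc k) (Pc h) (Pc h')).
have jn h : continuous h -> rnorm (j h) = sup_norm h.
  by move=> hc; rewrite rnorm_bfct (jK hc).
have LM k h : continuous h -> rnorm (L k h) <= (2 * r) * sup_norm h.
  move=> hc.
  have Phb := continuous_mulC (Pc h) (continuous_conjC (@bc k)).
  apply: le_trans (rnorm_integralC mu compactG Phb (continuous_fct_bounded compactG Phb)) _.
  rewrite -mulrA ler_wpM2l//; apply: (@le_trans _ _ (rnorm (P (j h)))).
    apply: sup_norm_le => x; rewrite rnormM rnormJ (rnorm_dual x (b_dual k)) mulr1.
    exact: rnorm_bfct_ub.
  by rewrite -(jn _ hc).
have M0 : 0 <= 2 * r by rewrite mulr_ge0.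
apply/ler_addgt0Pr => e e0.
(* Each of the [n] coefficients is off by at most [2 * r * e']. *)
pose e' := e / (n%:R * (2 * r) + 1).
have nr0 : 0 <= n%:R * (2 * r) by rewrite mulr_ge0.
have e'0 : 0 < e' by rewrite divr_gt0// ltr_wpDl.
have [s [s0 s1 sF]] := fourier_riemann_sum compactG haar b_dual fc e'0.
pose A k := \sum_(p <- s) (p.1%:C * b k (- p.2)) * L k (translate (- p.2) f).
have Ak k : rnorm (A k - L2_inner mu f (b k) : R[i]^o) <= 2 * r * e'.
  have := fourier_average b_dual (Llin k) M0 (LM k) fc (sF k).
  have Sb : S (b k) by apply: lin_span_mem; exists k.
  have -> : L k (b k) = 1.
    rewrite /L Pid (jK (@bc k))//.
    by rewrite (L2_inner_dual compactG haar (b_dual k) (b_dual k)) eqxx.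
  by rewrite mulr1.
(* Summing over [k] first reassembles the Fourier expansion of [P] of the translate, evaluated at
   [- p.2]: this undoes the translation at the point 0. What remains is a convex combination of
   values of modulus at most [r]. *)
have sumA : rnorm (\sum_(k < n) A k : R[i]^o) <= r.
  have -> : \sum_(k < n) A k =
      \sum_(p <- s) p.1%:C * bfct_val (P (j (translate (- p.2) f))) (- p.2).
    rewrite exchange_big /=; apply: eq_bigr => p _.
    rewrite [in RHS](fourier_expansion compactG haar b_inj b_dual (PS (j (translate (- p.2) f)))).
    rewrite fct_sumE mulr_sumr; apply: eq_bigr => k _.
    by rewrite -mulrA [b k _ * _]mulrC.
  apply: (le_trans (rnorm_sum _ _ _)).
  apply: (@le_trans _ _ (\sum_(p <- s) p.1 * r)); last by rewrite -mulr_suml s1 mul1r.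
  rewrite [leLHS]big_seq [leRHS]big_seq; apply: ler_sum => p /s0 p0.
  rewrite rnormM rnorm_real ger0_norm// ler_wpM2l//.
  apply: (le_trans (rnorm_bfct_ub _ _)); apply: (le_trans (Pr _)).
  rewrite -[leRHS]mulr1 ler_wpM2l// (jn _ (continuous_translate fc)).
  apply: sup_norm_le => x; rewrite (le_trans _ f1)//.
  exact: (sup_norm_ub _ (continuous_fct_bounded compactG fc)).
apply: (le_trans (Re_le_rnorm _)).
have -> : \sum_(k < n) L2_inner mu f (b k) =
    (\sum_(k < n) A k) - \sum_(k < n) (A k - L2_inner mu f (b k)).
  by rewrite sumrB opprB addrC subrK.
apply: (le_trans (rnormD _ _)); rewrite rnormN lerD//.
apply: (le_trans (rnorm_sum _ _ _)).
apply: (@le_trans _ _ (\sum_(k < n) (2 * r * e'))).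
  by apply: ler_sum => k _; exact: Ak.
rewrite sumr_const card_ord -[_ *+ n]mulr_natl [n%:R * (_ * _)]mulrA /e' mulrCA.
apply: ler_piMr; first exact: ltW.
by rewrite ler_pdivrMr ?mul1r ?ltr_wpDl// lerDl.
Qed.

(* Tested on [D / (|D| + d)], which tends to the sign of the kernel [D]. *)
Lemma projection_norm_ge : 0 <= r -> K <= r.
Proof.
move=> r0; apply/ler_addgt0Pr => d d0.
have rDc := continuous_rnorm Dc.
have pos x : 0 < rnorm (D x) + d by rewrite ltr_wpDl ?rnorm_ge0.
pose w x : R := (rnorm (D x) + d)^-1.
have wc : continuous w.
  move=> x; apply: cvgV; first by rewrite gt_eqF.
  by apply: cvgD; [exact: rDc|exact: cvg_cst].
have wcC : continuous (fun x => (w x)%:C : R[i]^o).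
  apply/continuous_ReIm; split; first exact: wc.
  by move=> x; exact: cvg_cst.
pose f x : R[i]^o := (w x)%:C * D x.
have fc : continuous f := continuous_mulC wcC Dc.
have w0 x : 0 < w x by rewrite invr_gt0.
have f1 : sup_norm f <= 1.
  apply: sup_norm_le => x; rewrite rnormM rnorm_real gtr0_norm//.
  by rewrite /w mulrC ler_pdivrMr// mul1r lerDl ltW.
have := projection_fourier_bound r0 fc f1.
pose v x := w x * rnorm (D x) ^+ 2.
have vc : continuous v.
  move=> x; apply: cvgM; first exact: wc.
  by rewrite expr2; apply: cvgM; exact: rDc.
have fbi k := integrableC_continuous mu compactG
  (continuous_mulC fc (continuous_conjC (@bc k))).
have [_ e] := integralC_sum (index_enum 'I_n) (fun=> 1) fbi.
have -> : \sum_(k < n) L2_inner mu f (b k) = (\int[mu]_x v x)%:C.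
  rewrite -integralC_real.
  transitivity (\sum_(k < n) 1 * integralC mu (fun x => f x * conjc (b k x))).
    by apply: eq_bigr => k _; rewrite mul1r.
  rewrite -e; apply: integralC_eq => x.
  under eq_bigr do rewrite mul1r.
  by rewrite -mulr_sumr -rmorph_sum /f -mulrA mulrJ_rnorm -rmorphM.
move=> vr; rewrite -lerBlDr; apply: le_trans vr.
rewrite -(Rintegral_probability_cst mu d) -RintegralB//.
- apply: le_Rintegral => //.
  + by apply: (integrable_continuous compactG) => // x; apply: cvgB; [exact: rDc|exact: cvg_cst].
  + exact: (integrable_continuous compactG).
  (* With [t] the modulus of [D x], this is [t - d <= t ^+ 2 / (t + d)], from
     [t ^+ 2 - d ^+ 2 <= t ^+ 2]. *)
  + move=> x _; rewrite /v /w mulrC ler_pdivlMr//.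
    by rewrite -subr_sqr lerBlDr lerDl sqr_ge0.
- exact: (integrable_continuous compactG).
- by apply: (integrable_continuous compactG) => // x; exact: cvg_cst.
Qed.

End Projection.

Lemma abs_proj_const_ge : (K%:E <= abs_proj_const S (@sup_norm R G))%E.
Proof.
pose j f : bfct R G := insubd (0 : bfct R G) f.
have Sb f : S f -> f \in @bounded_fct R G.
  by move=> Sf; exact: (continuous_fct_bounded compactG (span_dual_continuous b_dual Sf)).
have jK f : S f -> bfct_val (j f) = f by move=> /Sb fb; rewrite /j [LHS]insubdK.
have Slin a u v : S u -> S v -> S (a *: u + v) by exact: lin_span_range_lin.
apply: (@le_trans _ _ (rel_proj_const (j @` S))); last first.
  apply: ereal_sup_ubound; exists (bfct R G : completeNormedModType R[i]), j.
  split=> //; split => [a u v Su Sv|u Su].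
    by apply: val_inj; rewrite /= jK ?jK//; exact: Slin.
  by rewrite rnorm_bfct jK.
apply: le_ereal_inf_tmp => _ [P [Pc PP Prange] <-].
have PS y : S (bfct_val (P y)).
  have [s Ss <-] : (j @` S) (P y) by rewrite -Prange; exists y.
  by rewrite jK.
have Pid y : S (bfct_val y) -> P y = y.
  move=> Sy; have [z _ <-] : range P y.
    by rewrite Prange; exists (bfct_val y) => //; apply: val_inj; rewrite /= jK.
  exact: PP.
have := opnorm_ge0 P; case E : (opnorm P) => [r| |] // r0; last exact: leey.
by rewrite lee_fin; apply: (projection_norm_ge (opnorm_bound E) PS Pid).
Qed.

End ProjectionConstant.

(** * The upper bound *)

Section UpperBound.
Variables (R : realType) (G : topologicalZmodType).
Variable mu : probability (borel G) R.
Hypotheses (compactG : compact [set: G]) (haar : is_haar mu).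
Variables (n : nat) (b : 'I_n -> G -> R[i]^o).
Hypotheses (b_inj : injective b) (b_dual : forall k, dual_group R G (b k)).

Let bc k : continuous (b k). Proof. by case: (b_dual k). Qed.
Let S := lin_span (range b).
Let D x : R[i]^o := \sum_(k < n) b k x.
Let K : R := \int[mu]_x rnorm (D x).

Let Dc : continuous D.
Proof.
rewrite (_ : D = \sum_(k < n) 1 *: b k); first exact: (continuous_sum bc).
by apply/funext => x; rewrite fct_sumE; apply: eq_bigr => k _; rewrite scale1r.
Qed.

Let kernelE x t : rnorm (\sum_(l < n) conjc (b l t) * b l x : R[i]^o) = rnorm (D (- x + t)).
Proof.
rewrite -[LHS]rnormJ; congr rnorm; rewrite rmorph_sum; apply: eq_bigr => l _ /=.
have [_ _ bM] := b_dual l.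
by rewrite rmorphM /= conjcK (dualJ _ (b_dual l)) mulrC -bM.
Qed.

(** The same sample has to control the norm of the discretized convolution, through the translates
    of [|D|], and its action on the basis, through the Gram matrix of the characters. Invariance of
    the measure makes the first integral [K] for every [x]. *)
Lemma kernel_riemann_sum (e : R) : 0 < e ->
  exists s : seq (R * G), [/\ forall p, p \in s -> 0 <= p.1,
    forall x, \sum_(p <- s) p.1 * rnorm (D (- x + p.2)) <= K + e &
    forall l k, rnorm (\sum_(p <- s) p.1%:C * (conjc (b l p.2) * b k p.2)
      - (k == l)%:R : R[i]^o) <= e].
Proof.
move=> e0.
(* [None] is the norm kernel and [Some (l, k)] a Gram entry; the latter does not depend on [x] and
   is read off at [x = 0]. *)
pose F (i : option ('I_n * 'I_n)) x t : R[i]^o :=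
  if i is Some lk then b lk.2 t * conjc (b lk.1 t) else (rnorm (D (- x + t)))%:C.
have subc : continuous (fun p : G * G => - p.1 + p.2).
  move=> p; apply: (@continuous_comp _ _ _ (fun p : G * G => (- p.1, p.2))
    (fun p : G * G => p.1 + p.2)); last exact: add_continuous.
  apply: cvg_pair; last exact: cvg_snd.
  apply: (@continuous_comp _ _ _ fst -%R); first exact: cvg_fst.
  exact: opp_continuous.
have rDc := continuous_rnorm Dc.
have Fc i : continuous (fun p : G * G => F i p.1 p.2).
  case: i => [[l k]|] /=.
    have cb m : continuous (fun p : G * G => b m p.2).
      move=> p; apply: (@continuous_comp _ _ _ snd (b m)); first exact: cvg_snd.
      exact: bc.
    exact: (continuous_mulC (cb k) (continuous_conjC (cb l))).
  apply/continuous_ReIm; split; last by move=> p; exact: cvg_cst.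
  move=> p; apply: (@continuous_comp _ _ _ (fun p : G * G => - p.1 + p.2)
    (fun x => rnorm (D x))); [exact: subc|exact: rDc].
have [s [s0 s1 sF]] := riemann_sumC mu compactG Fc e0.
exists s; split=> //.
  move=> x; have := sF None x.
  rewrite integralC_real (Rintegral_translate compactG _ haar rDc).
  have -> : \sum_(p <- s) p.1%:C * F None x p.2 = (\sum_(p <- s) p.1 * rnorm (D (- x + p.2)))%:C.
    by rewrite rmorph_sum; apply: eq_bigr => p _; rewrite /F -rmorphM.
  rewrite -rmorphB rnorm_real => /ler_normlW; rewrite -/K; lra.
move=> l k; have := sF (Some (l, k)) 0.
rewrite [integralC _ _](L2_inner_dual compactG haar (b_dual k) (b_dual l)) (inj_eq b_inj).
congr (rnorm (_ - _) <= _); apply: eq_bigr => p _.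
by congr (_ * _); rewrite /F mulrC.
Qed.

Variables (Y : normedModType R[i]) (j : (G -> R[i]^o) -> Y).
Hypothesis jS : isometric_embedding S (@sup_norm R G) j.

Let jlin : forall a u v, S u -> S v -> j (a *: u + v) = a *: j u + j v := jS.1.

Let S0 : S 0. Proof. exact: lin_span_range0. Qed.
Let Slin a u v : S u -> S v -> S (a *: u + v). Proof. exact: lin_span_range_lin. Qed.
Let Sb k : S (b k). Proof. by apply: lin_span_mem; exists k. Qed.

Let jsum (c : 'I_n -> R[i]) :
  S (\sum_(k < n) c k *: b k) /\ j (\sum_(k < n) c k *: b k) = \sum_(k < n) c k *: j (b k).
Proof.
have j0 : j 0 = 0.
  by have := jlin (-1) S0 S0; rewrite scaler0 addr0 scaleN1r addNr.
elim/big_rec2: _ => [|k y u _ [Su ju]]; first by [].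
by split; [exact: Slin|rewrite jlin// ju].
Qed.

Let Sbounded s : S s -> s \in @bounded_fct R G.
Proof. by move=> Ss; exact: (continuous_fct_bounded compactG (span_dual_continuous b_dual Ss)). Qed.

(** The bound 1 has to be sharp, since these functionals carry the main term of the projection. *)
Lemma evaluation_extension x : exists phi : Y -> R[i]^o,
  [/\ forall a y z, phi (a *: y + z) = a *: phi y + phi z,
      forall y, rnorm (phi y) <= 1 * rnorm y &
      forall s, S s -> phi (j s) = s x].
Proof.
apply: (@Hahn_Banach _ _ 1 ler01 _ S j (fun s => s x)) => //.
move=> s Ss; rewrite mul1r jS.2//; exact: (sup_norm_ub x (Sbounded Ss)).
Qed.

(** Needed to define the correction on all of [Y]; its bound 2 is only ever multiplied by a small
    error. *)
Lemma coefficient_extension k : exists psi : Y -> R[i]^o,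
  [/\ forall a y z, psi (a *: y + z) = a *: psi y + psi z,
      forall y, rnorm (psi y) <= 2 * rnorm y &
      forall s, S s -> psi (j s) = L2_inner mu s (b k)].
Proof.
have Sc s : S s -> continuous s by exact: span_dual_continuous.
apply: (@Hahn_Banach _ _ 2 _ _ S j (fun s => L2_inner mu s (b k))) => //.
  move=> a u v Su Sv.
  exact: (L2_inner_comb mu compactG a (@bc k) (Sc _ Su) (Sc _ Sv)).
move=> s Ss; have sb := continuous_mulC (Sc _ Ss) (continuous_conjC (@bc k)).
apply: le_trans (rnorm_integralC mu compactG sb (continuous_fct_bounded compactG sb)) _.
rewrite jS.2// ler_wpM2l//; apply: sup_norm_le => x.
rewrite rnormM rnormJ (rnorm_dual x (b_dual k)) mulr1.
exact: (sup_norm_ub x (Sbounded Ss)).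
Qed.

(* [a] discretizes the convolution with the kernel [D]; it is almost the
   identity on [S], and the [psi] part corrects it to a projection. *)
Lemma almost_optimal_projection (e : R) : 0 < e -> exists P : Y -> Y,
  [/\ forall a y z, P (a *: y + z) = a *: P y + P z,
      forall y, rnorm (P y) <= (K + e + n%:R * (n%:R * (2 * e))) * rnorm y,
      forall y, (j @` S) (P y) & forall s, S s -> P (j s) = j s].
Proof.
move=> e0; have [s [s0 sK sE]] := kernel_riemann_sum e0.
have [phi phiP] := choice evaluation_extension.
have [psi psiP] := choice coefficient_extension.
pose a l y : R[i] := \sum_(p <- s) p.1%:C * (conjc (b l p.2) * phi p.2 y).
(* [E l k] is the defect of [a l] at [j (b k)], whose exact value should be [(k == l)%:R].
   Subtracting it, weighted by the coefficients [psi k], makes [c l] exact on [S]. *)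
pose E l k : R[i] := \sum_(p <- s) p.1%:C * (conjc (b l p.2) * b k p.2) - (k == l)%:R.
pose c l y : R[i] := a l y - \sum_(k < n) psi k y * E l k.
have alin l (r : R[i]) y z : a l (r *: y + z) = r * a l y + a l z.
  rewrite mulr_sumr -big_split /=; apply: eq_bigr => p _.
  have [-> _ _] := phiP p.2; rewrite 2!mulrDr; congr (_ + _).
  rewrite -[r *: _]/(r * phi p.2 y); ring.
have clin l (r : R[i]) y z : c l (r *: y + z) = r * c l y + c l z.
  rewrite /c alin mulrBr addrACA -opprD; congr (_ - _).
  rewrite mulr_sumr -big_split /=; apply: eq_bigr => k _.
  have [-> _ _] := psiP k; rewrite mulrDl; congr (_ + _).
  by rewrite -[r *: _]/(r * psi k y) mulrA.
pose P y := \sum_(l < n) c l y *: j (b l).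
exists P; split.
- move=> r y z; rewrite /P scaler_sumr -big_split /=; apply: eq_bigr => l _.
  by rewrite clin scalerDl scalerA.
- move=> y; have [Sy jy] := jsum (c^~ y).
  (* Since [j] is isometric on [S], the norm of [P y] is a supremum over [x]. The main part is
     bounded by the sampled integral of the translated [|D|], at most [K + e]; the correction has
     [n] times [n] terms, each at most [2 * e], all multiplied by [rnorm y]. *)
  rewrite /P -jy jS.2//; apply: sup_norm_le => x; rewrite fct_sumE.
  have y0 := rnorm_ge0 y.
  have -> : \sum_(l < n) (c l y *: b l) x =
      \sum_(p <- s) (p.1%:C * phi p.2 y) * (\sum_(l < n) conjc (b l p.2) * b l x)
      - \sum_(l < n) (\sum_(k < n) psi k y * E l k) * b l x.
    transitivity (\sum_(l < n) (a l y * b l x - (\sum_(k < n) psi k y * E l k) * b l x)).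
      by apply: eq_bigr => l _; rewrite -mulrBl.
    rewrite sumrB; congr (_ - _).
    under [RHS]eq_bigr do rewrite mulr_sumr.
    rewrite [RHS]exchange_big /=; apply: eq_bigr => l _.
    rewrite mulr_suml; apply: eq_bigr => p _; ring.
  apply: (le_trans (rnormD _ _)); rewrite rnormN mulrDl lerD//.
    apply: (le_trans (rnorm_sum _ _ _)).
    apply: (@le_trans _ _ (\sum_(p <- s) p.1 * rnorm (D (- x + p.2)) * rnorm y)); last first.
      by rewrite -mulr_suml ler_wpM2r.
    rewrite [leLHS]big_seq [leRHS]big_seq; apply: ler_sum => p /s0 p0.
    rewrite 2!rnormM rnorm_real ger0_norm// kernelE -!mulrA ler_wpM2l// mulrC.
    rewrite ler_wpM2l ?rnorm_ge0//; have [_ h _] := phiP p.2.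
    by rewrite (le_trans (h y))// mul1r.
  apply: (le_trans (rnorm_sum _ _ _)).
  rewrite -mulrA mulr_natl -[X in _ *+ X]card_ord -sumr_const.
  apply: ler_sum => l _; rewrite rnormM (rnorm_dual x (b_dual l)) mulr1.
  apply: (le_trans (rnorm_sum _ _ _)).
  rewrite -mulrA mulr_natl -[X in _ *+ X]card_ord -sumr_const.
  apply: ler_sum => k _; rewrite rnormM mulrAC.
  have [_ h _] := psiP k; rewrite ler_pM ?rnorm_ge0//.
  exact: sE.
- by move=> y; have [Sy jy] := jsum (c^~ y); exists (\sum_(l < n) c l y *: b l).
- move=> u Su; have uE := fourier_expansion compactG haar b_inj b_dual Su.
  have ck k : psi k (j u) = L2_inner mu u (b k) by have [_ _] := psiP k; exact.
  have cl l : c l (j u) = L2_inner mu u (b l).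
    have aE : a l (j u) = \sum_(k < n) L2_inner mu u (b k) *
        (\sum_(p <- s) p.1%:C * (conjc (b l p.2) * b k p.2)).
      under [RHS]eq_bigr do rewrite mulr_sumr.
      rewrite [RHS]exchange_big /=; apply: eq_bigr => p _.
      have [_ _ ->//] := phiP p.2; rewrite {1}uE fct_sumE !mulr_sumr.
      apply: eq_bigr => k _.
      rewrite -[(_ *: _) _]/(L2_inner mu u (b k) * b k p.2); ring.
    rewrite /c; under eq_bigr do rewrite ck mulrBr.
    rewrite sumrB opprB addrCA -aE subrr addr0 (bigD1 l)//= eqxx mulr1.
    by rewrite big1 ?addr0// => k /negbTE ->; rewrite mulr0.
  rewrite /P [in RHS]uE (jsum _).2; apply: eq_bigr => l _.
  by rewrite cl.
Qed.

Lemma rel_proj_const_le : (rel_proj_const (j @` S) <= K%:E)%E.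
Proof.
apply/lee_addgt0Pr => e e0.
(* The total error of the almost optimal projection at accuracy [d] is [m * d], so the accuracy
   [e / m] gives the bound [K + e]. *)
pose m : R := 1 + n%:R * (n%:R * 2).
have m0 : 0 < m by rewrite ltr_wpDr// !mulr_ge0.
have d0 : 0 < e / m by rewrite divr_gt0.
have [P [Plin PK PS Pid]] := almost_optimal_projection d0.
pose PL : {linear Y -> Y} := HB.pack P (GRing.isLinear.Build _ _ _ _ P Plin).
have KE : K + e / m + n%:R * (n%:R * (2 * (e / m))) = K + e.
  rewrite -addrA; congr (_ + _).
  have -> : e / m + n%:R * (n%:R * (2 * (e / m))) = m * (e / m) by rewrite /m; ring.
  by rewrite mulrCA mulfV ?mulr1 ?gt_eqF.
rewrite KE in PK.
have Ke0 : 0 <= K + e.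
  apply: addr_ge0; last exact: ltW.
  by rewrite /K; apply: Rintegral_ge0 => x _; exact: rnorm_ge0.
apply: (@le_trans _ _ (opnorm PL)).
  apply: ereal_inf_lbound; exists PL => //; split.
  - apply: bounded_linear_continuous; apply/bounded_funP => r.
    exists ((K + e)%:C * r) => y yr; rewrite -rnormE.
    apply: (@le_trans _ _ ((K + e)%:C * `|y|)).
      by rewrite -(rnormE y) -rmorphM lecR; exact: PK.
    by rewrite ler_wpM2l// ler0c.
  - by move=> y; have [u Su /= <-] := PS y; exact: Pid.
  - apply/seteqP; split => [_ [y _ <-]|_ [u Su <-]]; first exact: PS.
    by exists (j u) => //; exact: Pid.
apply: ge_ereal_sup => _ [y y1 <-]; rewrite lee_fin.
apply: (le_trans (PK y)); rewrite -[leRHS]mulr1 ler_wpM2l//.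
by rewrite rnorm_le.
Qed.

End UpperBound.

(** * Invariant subspaces *)

(** Induction on the rank of [W], which works for infinite families. If every [A i] is scalar on
    [W], any nonzero row will do; otherwise an eigenspace of a non-scalar [A i] cuts [W] down to a
    nonzero smaller space, stable under the family by commutation. *)
Lemma common_eigenvector_family (C : numClosedFieldType) (I : Type) n
    (A : I -> 'M[C]_n) (W : 'M[C]_n) :
  W != 0 -> (forall i, stablemx W (A i)) -> (forall i i', comm_mx (A i) (A i')) ->
  exists v : 'rV_n, [/\ v != 0, (v <= W)%MS & forall i, exists c, v *m A i = c *: v].
Proof.
have [r] := ubnP (\rank W); elim: r W => // r IH W rW W0 stW comA.
have [scal|] := pselect (forall i, exists c, W *m A i = c *: W).
  exists (nz_row W); split; rewrite ?nz_row_eq0 ?nz_row_sub// => i.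
  have /submxP[u ->] := nz_row_sub W; have [c Wc] := scal i.
  by exists c; rewrite -mulmxA Wc scalemxAr.
move=> /existsNP[i /forallNP nscal].
(* The matrix of [A i] restricted to [W], in the basis [row_base W]. *)
pose B := row_base W *m A i *m pinvmx (row_base W).
have BE : row_base W *m A i = B *m row_base W.
  rewrite mulmxKpV// eq_row_base.
  by apply: submx_trans (stW i); rewrite submxMr// eq_row_base.
have [a /eigenvalueP[u uB u0]] : exists a, eigenvalue B a.
  by apply: eigenvalue_closed; rewrite lt0n mxrank_eq0.
pose W' := (W :&: eigenspace (A i) a)%MS.
have W'0 : W' != 0.
  apply/negP => /eqP W'0; have : (u *m row_base W <= W')%MS.
    rewrite sub_capmx -{1}(eq_row_base W) submxMl /=.
    by apply/eigenspaceP; rewrite -mulmxA BE mulmxA uB scalemxAl.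
  by rewrite W'0 submx0 mulmx_free_eq0 ?row_base_free// (negbTE u0).
have WW' : (W' <= W)%MS := capmxSl _ _.
have W'W : (\rank W' < \rank W)%N.
  rewrite ltn_neqAle mxrankS ?capmxSl// andbT; apply/negP => rk.
  apply: (nscal a); apply/eigenspaceP.
  have : (W <= W')%MS.
    by rewrite -(geq_leqif (mxrank_leqif_sup WW')) (eqP rk).
  by move=> /submx_trans; apply; exact: capmxSr.
have stW' k : stablemx W' (A k).
  rewrite sub_capmx (submx_trans (submxMr _ (capmxSl _ _)) (stW k)) /=.
  apply: (submx_trans (submxMr _ (capmxSr _ _))).
  exact: comm_mx_stable_eigenspace.
have [|v [v0 vW' vA]] := IH _ _ W'0 stW' comA; first exact: leq_trans W'W _.
by exists v; split=> //; exact: submx_trans vW' WW'.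
Qed.

(** A generator with nonzero coefficient in a vanishing combination is redundant; removing such
    generators one at a time ends with a free family. *)
Lemma findim_subspace_basis (R : realType) (V : lmodType R[i]) (S : set V) :
  findim_subspace S -> exists n (b : 'I_n -> V), S = lin_span (range b) /\
    forall c : 'I_n -> R[i], \sum_(k < n) c k *: b k = 0 -> forall k, c k = 0.
Proof.
move=> [B [fB ->]]; have [n [b [_ -> _]]] := finite_set_enum fB.
elim: n b => [|n IH] b; first by exists 0, b; split=> // c _ [].
have [|] := pselect (forall c : 'I_n.+1 -> R[i],
    \sum_(k < n.+1) c k *: b k = 0 -> forall k, c k = 0); first by exists n.+1, b.
move=> /existsNP[c /not_implyP[c0 /existsNP[k /eqP ck]]].
have [n' [b' [bE b'free]]] := IH (b \o lift k).
exists n', b'; split=> //; rewrite -bE; apply/seteqP; split.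
- apply: lin_span_min; first exact: lin_span_range0.
    by move=> *; exact: lin_span_range_lin.
  move=> _ [l _ <-]; have [->|kl] := eqVneq l k; last first.
    rewrite eq_sym in kl; have [l' -> _] := unlift_some kl.
    by apply: (@lin_span_mem R V); exists l'.
  apply/lin_span_rangeP; exists (fun l => - (c (lift k l) / c k)).
  move: c0; rewrite (bigD1_ord k)//= => /eqP; rewrite addr_eq0 => /eqP ckE.
  apply: (scalerI ck); rewrite ckE -sumrN scaler_sumr; apply: eq_bigr => l' _.
  by rewrite scalerA mulrN mulrCA mulfV// mulr1 scaleNr.
- apply: lin_span_min; first exact: lin_span_range0.
    by move=> *; exact: lin_span_range_lin.
  by move=> _ [l _ <-]; apply: lin_span_mem; exists (lift k l).
Qed.

Section LeftInvariant.
Variables (R : realType) (G : topologicalZmodType).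
Variable mu : probability (borel G) R.
Hypotheses (compactG : compact [set: G]) (haar : is_haar mu).

(* A bounded multiplicative function has modulus at most 1: multiplying its
   supremum [s] by any of its values gives at most [s]. *)
Lemma dual_of_eigenfunction (f : G -> R[i]^o) : continuous f -> f != 0 ->
  (forall g, exists c : R[i], translate g f = c *: f) ->
  dual_group R G ((f 0)^-1 *: f).
Proof.
move=> fc f0 fe.
(* Translation by [- g] has an eigenvalue [c], and both sides equal [c * f 0 * f x]. *)
have fM g x : f (g + x) * f 0 = f g * f x.
  have [c cE] := fe (- g).
  have E y : f (g + y) = c * f y.
    by have := congr1 (fun h => h y) cE; rewrite /translate opprK.
  by rewrite -[in f g](addr0 g) !E mulrAC.
have f00 : f 0 != 0.
  apply: contraNneq f0 => f00; apply/eqP/funext => x; apply/eqP.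
  have := fM x x; rewrite f00 mulr0 => /esym/eqP.
  by rewrite mulf_eq0 orbb.
pose chi : G -> R[i]^o := (f 0)^-1 *: f.
have chic : continuous chi.
  exact: (continuous_mulC (@continuous_cstC R G (f 0)^-1) fc).
have chiM x y : chi (x + y) = chi x * chi y.
  rewrite -[LHS]/((f 0)^-1 * f (x + y)) -[RHS]/((f 0)^-1 * f x * ((f 0)^-1 * f y)).
  by rewrite mulrACA -fM [f (x + y) * _]mulrC -mulrA mulKf.
have chi0 : chi 0 = 1 by rewrite -[LHS]/((f 0)^-1 * f 0) mulVf.
have r_le1 x : rnorm (chi x) <= 1.
  have bchi := continuous_fct_bounded compactG chic.
  have s0 : 0 < sup_norm chi.
    by apply: lt_le_trans (sup_norm_ub 0 bchi); rewrite chi0 (rnorm_real 1) normr1.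
  rewrite leNgt; apply/negP => r1; have rx : 0 < rnorm (chi x) := lt_trans ltr01 r1.
  have : sup_norm chi <= sup_norm chi / rnorm (chi x).
    apply: sup_norm_le => y; rewrite ler_pdivlMr// -rnormM -chiM.
    exact: (sup_norm_ub _ bchi).
  by rewrite ler_pdivlMr// leNgt ltr_pMr// r1.
split; [exact: chic|move=> x|exact: chiM].
rewrite -[LHS](@rnormE R R[i]^o); congr (_%:C); apply/le_anti.
rewrite r_le1 /=; have := r_le1 (- x).
have : rnorm (chi x) * rnorm (chi (- x)) = 1.
  by rewrite -rnormM -chiM subrr chi0 (rnorm_real 1) normr1.
by move=> E h; rewrite -{1}E -[leRHS]mulr1 ler_wpM2l// rnorm_ge0.
Qed.

Lemma left_invariant_span_dual (S : set (G -> R[i]^o)) :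
  S `<=` continuous_functions R G -> findim_subspace S -> left_invariant S ->
  exists Lambda : set (G -> R[i]^o),
    [/\ finite_set Lambda, Lambda `<=` dual_group R G & S = lin_span Lambda].
Proof.
move=> SC /findim_subspace_basis[n [b [SE bfree]]] Sinv.
(* Coordinates identify [S] with row vectors, so that translations become the matrices [A g] acting
   on the right. *)
pose phi (v : 'rV[R[i]]_n) : G -> R[i]^o := \sum_(k < n) v 0 k *: b k.
have Slin a u v : S u -> S v -> S (a *: u + v).
  by rewrite SE; exact: lin_span_range_lin.
have Sphi v : S (phi v) by rewrite SE; apply/lin_span_rangeP; exists (v 0).
have phiS f : S f -> exists v, f = phi v.
  rewrite SE => /lin_span_rangeP[c ->]; exists (\row_k c k).
  by apply: eq_bigr => k _; rewrite mxE.
have phi0 v : phi v = 0 -> v = 0.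
  by move=> /bfree v0; apply/rowP => k; rewrite v0 mxE.
have phi00 : phi 0 = 0 by rewrite /phi big1// => k _; rewrite mxE scale0r.
have phiD a u v : phi (a *: u + v) = a *: phi u + phi v.
  rewrite /phi scaler_sumr -big_split /=; apply: eq_bigr => k _.
  by rewrite !mxE scalerDl scalerA.
have phi_inj u v : phi u = phi v -> u = v.
  move=> uv; apply/eqP; rewrite -subr_eq0; apply/eqP/phi0.
  by rewrite addrC -scaleN1r phiD uv scaleN1r addNr.
have bc k : continuous (b k).
  by apply: SC; rewrite SE; apply: lin_span_mem; exists k.
have phic v : continuous (phi v) by exact: SC.
have /choice[A AE] : forall g, exists A : 'M[R[i]]_n,
    forall k, translate g (b k) = phi (row k A).
  move=> g; have /choice[w wE] : forall k, exists w, translate g (b k) = phi w.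
    by move=> k; apply: phiS; apply: Sinv; rewrite SE; apply: lin_span_mem; exists k.
  exists (\matrix_k w k) => k; by rewrite rowK.
have phiA g v : translate g (phi v) = phi (v *m A g).
  have -> : translate g (phi v) = \sum_(k < n) v 0 k *: translate g (b k).
    by apply/funext => x; rewrite /translate /phi !fct_sumE.
  under eq_bigr do rewrite AE.
  rewrite /phi; under eq_bigr do rewrite scaler_sumr.
  rewrite exchange_big /=; apply: eq_bigr => l _.
  rewrite mxE scaler_suml; apply: eq_bigr => k _.
  by rewrite scalerA mxE.
(* This is where commutativity of the group enters. *)
have Acomm g h : comm_mx (A g) (A h).
  apply/row_matrixP => k; rewrite !rowE; apply: phi_inj; rewrite !mulmxA -!phiA.
  by apply/funext => x; rewrite /translate addrCA.
pose Lambda : set (G -> R[i]^o) := S `&` dual_group R G.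
(* Distinct characters are orthonormal, hence linearly independent in the n-dimensional space [S];
   so a list of characters of [S] of maximal length exhausts them. *)
have card_bound (L : seq (G -> R[i]^o)) : uniq L -> (forall x, x \in L -> Lambda x) ->
    (size L <= n)%N.
  move=> uL LL; pose gam (i : 'I_(size L)) := tnth (in_tuple L) i.
  have gamL i : Lambda (gam i) by apply: LL; exact: mem_tnth.
  have gam_inj : injective gam.
    move=> i k; rewrite /gam; have [x0] : exists x0 : G -> R[i]^o, True by exists (gam i).
    rewrite !(tnth_nth x0) => _ /eqP.
    by rewrite nth_uniq// => /eqP/val_inj.
  have gam_dual i : dual_group R G (gam i) := (gamL i).2.
  have /choice[w wE] : forall i, exists w, gam i = phi w.
    by move=> i; apply: phiS; exact: (gamL i).1.
  have : row_free (\matrix_i w i).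
    rewrite -kermx_eq0; apply/rowV0P => v /sub_kermxP vM.
    apply/rowP => i; rewrite mxE.
    have v0 : \sum_(l < size L) v 0 l *: gam l = 0.
      have -> : \sum_(l < size L) v 0 l *: gam l = phi (v *m \matrix_l w l).
        under eq_bigr do rewrite wE /phi scaler_sumr.
        rewrite exchange_big /=; apply: eq_bigr => k _.
        rewrite mxE scaler_suml; apply: eq_bigr => l _.
        by rewrite scalerA mxE.
      by rewrite vM /phi big1// => k _; rewrite mxE scale0r.
    rewrite -(L2_inner_comb_dual compactG haar gam_inj gam_dual (v 0) i) v0.
    have zero : L2_inner mu 0 (gam i) = integralC mu (fun=> 0 : R[i]^o).
      by apply: integralC_eq => x; rewrite [LHS]mul0r.
    by rewrite zero integralC_cst.
  by rewrite /row_free => /eqP <-; exact: rank_leq_col.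
have [L [uL LL Lmax]] : exists L : seq (G -> R[i]^o), [/\ uniq L,
    forall x, x \in L -> Lambda x & forall x, Lambda x -> x \in L].
  pose Q m := `[< exists L : seq (G -> R[i]^o), [/\ uniq L,
    forall x, x \in L -> Lambda x & size L = m] >].
  have Q0 : exists m, Q m by exists 0; apply/asboolP; exists [::].
  have Qn m : Q m -> (m <= n)%N.
    by move=> /asboolP[L [uL LL <-]]; exact: card_bound.
  case: (ex_maxnP Q0 Qn) => m /asboolP[L [uL LL Lm]] mmax.
  exists L; split=> // x Lx; apply: contrapT => /negP xL.
  have /mmax : Q m.+1.
    apply/asboolP; exists (x :: L); split=> /=; rewrite ?xL ?Lm//.
    by move=> y; rewrite inE => /orP[/eqP ->|/LL].
  by rewrite ltnn.
have LamE : Lambda = [set` L] by apply/seteqP; split=> x; [exact: Lmax|exact: LL].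
exists Lambda; split; [by rewrite LamE|by move=> x []|].
have finL : finite_set Lambda by rewrite LamE.
have [m [gam [gam_inj gamE _]]] := finite_set_enum finL.
have gamL i : Lambda (gam i) by rewrite gamE; exists i.
have gam_dual i : dual_group R G (gam i) := (gamL i).2.
have gamc i : continuous (gam i) by case: (gam_dual i).
(* The kernel of [N] consists of the coordinates of the elements of [S] orthogonal to all characters
   of [S]. *)
pose N : 'M[R[i]]_(n, m) := \matrix_(k, i) L2_inner mu (b k) (gam i).
have phiN v i : (v *m N) 0 i = L2_inner mu (phi v) (gam i).
  have bgi k := integrableC_continuous mu compactG
    (continuous_mulC (bc k) (continuous_conjC (gamc i))).
  have [_ e] := integralC_sum (index_enum 'I_n) (v 0) bgi.
  rewrite mxE; under eq_bigr do rewrite mxE.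
  rewrite -e; apply: integralC_eq => x; rewrite /phi fct_sumE mulr_suml.
  by apply: eq_bigr => k _; rewrite -mulrA.
have stW g : stablemx (kermx N) (A g).
  apply/row_subP => k; apply/sub_kermxP/rowP => i.
  rewrite row_mul phiN -phiA (L2_inner_translate compactG haar g (gam_dual i) (@phic _)).
  have /sub_kermxP/rowP/(_ i) := row_sub k (kermx N).
  by rewrite phiN !mxE => ->; rewrite mulr0.
(* A common eigenfunction in the kernel, once normalized, would be a character of [S] orthogonal to
   itself. *)
have W0 : kermx N = 0.
  apply/eqP/negPn/negP => W0.
  have [v [v0 /sub_kermxP vN vA]] := common_eigenvector_family W0 stW Acomm.
  have fv0 : phi v != 0 by apply: contraNneq v0 => /phi0 ->.
  have fe g : exists c : R[i], translate g (phi v) = c *: phi v.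
    have [c vc] := vA g; exists c; rewrite phiA vc.
    rewrite /phi scaler_sumr; apply: eq_bigr => k _; by rewrite mxE scalerA.
  have chi_dual := dual_of_eigenfunction (@phic v) fv0 fe.
  set a := (phi v 0)^-1 in chi_dual.
  have Sa : S (a *: phi v).
    by have := Slin a _ _ (Sphi v) (Sphi 0); rewrite phi00 addr0.
  have : Lambda (a *: phi v) by [].
  rewrite gamE => -[i _ iE].
  have := L2_inner_dual compactG haar (gam_dual i) (gam_dual i).
  rewrite eqxx {1}iE.
  have [_ e] := integralCZ a (integrableC_continuous mu compactG
    (continuous_mulC (@phic v) (continuous_conjC (gamc i)))).
  have -> : L2_inner mu (a *: phi v) (gam i) = a * L2_inner mu (phi v) (gam i).
    by rewrite -e; apply: integralC_eq => x; rewrite mulrA.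
  rewrite -phiN vN mxE mulr0 => /eqP.
  by rewrite eq_sym oner_eq0.
apply/seteqP; split.
  move=> f Sf; rewrite gamE; apply/lin_span_rangeP.
  exists (fun i => L2_inner mu f (gam i)).
  have fc : continuous f := SC _ Sf.
  have Sgam : S (\sum_(i < m) L2_inner mu f (gam i) *: gam i).
    by elim/big_rec: _ => [|i g _ Sg]; [rewrite -phi00|exact: (Slin _ _ _ (gamL i).1 Sg)].
  (* The difference between [f] and its Fourier sum lies in [S] and is orthogonal to [Lambda], so
     its coordinates are in the zero kernel. *)
  have [u uE] := phiS _ (Slin (-1) _ _ Sgam Sf).
  have u0 : u = 0.
    apply/eqP; rewrite -submx0 -W0; apply/sub_kermxP/rowP => i.
    rewrite phiN -uE mxE (L2_inner_comb mu compactG _ (gamc i) (SC _ Sgam) fc).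
    by rewrite (L2_inner_comb_dual compactG haar gam_inj gam_dual) mulN1r addNr.
  by move/eqP: uE; rewrite u0 phi00 scaleN1r addrC subr_eq0 => /eqP.
rewrite gamE SE; apply: lin_span_min; first exact: lin_span_range0.
  by move=> *; exact: lin_span_range_lin.
by move=> _ [i _ <-]; rewrite -SE; exact: (gamL i).1.
Qed.

End LeftInvariant.

(** * The equivalences and the formula for the projection constant *)

Lemma span_dual_left_invariant (R : realType) (G : topologicalZmodType) n
    (b : 'I_n -> G -> R[i]^o) : (forall k, dual_group R G (b k)) ->
  left_invariant (lin_span (range b)).
Proof.
move=> bd g _ /lin_span_rangeP[c ->]; apply/lin_span_rangeP.
exists (fun k => c k * b k (- g)); apply/funext => x.
rewrite /translate !fct_sumE; apply: eq_bigr => k _; have [_ _ bM] := bd k.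
by rewrite -[LHS]/(c k * b k (- g + x)) bM mulrA.
Qed.

Theorem theorem1p3 (R : realType) (G : topologicalZmodType)
    (compactG : compact [set: G]) (hausdorffG : hausdorff_space G)
    (mu : probability (borel G) R) (haar_mu : is_haar mu)
    (S : set (G -> R[i]^o)) (SC : S `<=` continuous_functions R G)
    (fdS : findim_subspace S) :
  [<-> left_invariant S;
       left_accessible mu S;
       exists Lambda : set (G -> R[i]^o),
         [/\ finite_set Lambda, Lambda `<=` dual_group R G &
             S = lin_span Lambda]] /\
  (forall Lambda : set (G -> R[i]^o),
     finite_set Lambda -> Lambda `<=` dual_group R G -> S = lin_span Lambda ->
     abs_proj_const S (@sup_norm R G) =
       (\int[mu]_x (rnorm (\sum_(gamma \in Lambda) gamma x))%:E)%E).
Proof.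
split.
  tfae.
  - move=> Sinv.
    have [Lambda [finL dualL SE]] := left_invariant_span_dual compactG haar_mu SC fdS Sinv.
    have [n [b [b_inj LE _]]] := finite_set_enum finL.
    rewrite LE in SE dualL.
    have b_dual k : dual_group R G (b k) by apply: dualL; exists k.
    split=> //; exists (fun f => \sum_(k < n) L2_inner mu f (b k) *: b k); split.
      by rewrite SE; exact: L2_orthogonal_projection_fourier.
    move=> Q Qeq f fc.
    exact: (equivariant_projection_fourier compactG haar_mu b_inj b_dual SE Qeq fc).
  - by case=> _ Sinv _; exact: (left_invariant_span_dual compactG haar_mu).
  - case=> Lambda [finL dualL ->].
    have [n [b [_ LE _]]] := finite_set_enum finL; rewrite LE in dualL *.
    by apply: span_dual_left_invariant => k; apply: dualL; exists k.
move=> Lambda finL dualL SE.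
have [n [b [b_inj LE sumE]]] := finite_set_enum finL; rewrite LE in SE dualL.
have b_dual k : dual_group R G (b k) by apply: dualL; exists k.
have Dc : continuous (\sum_(k < n) 1 *: b k).
  by apply: continuous_sum => k; case: (b_dual k).
have DE x : (\sum_(k < n) 1 *: b k) x = \sum_(k < n) b k x.
  by rewrite fct_sumE; apply: eq_bigr => k _; rewrite scale1r.
(* The extended-real integral is finite because the kernel is continuous on a compact group, so it
   is the real number of the two bounds. *)
have -> : (\int[mu]_x (rnorm (\sum_(gamma \in Lambda) gamma x))%:E)%E =
    (\int[mu]_x rnorm (\sum_(k < n) b k x))%:E.
  rewrite /Rintegral fineK; first by apply: eq_integral => x _; rewrite sumE.
  apply: integrable_fin_num => //.
  have := integrable_continuous compactG mu measurableT (continuous_rnorm Dc).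
  by congr (mu.-integrable _ _); apply/funext => x /=; rewrite DE.
apply/le_anti/andP; split; last first.
  by rewrite SE; exact: abs_proj_const_ge.
apply: ge_ereal_sup => _ [Y [j [jS ->]]]; rewrite SE in jS *.
exact: rel_proj_const_le.
Qed.
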